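(* Let $(X,d)=(X_1,d_1)\times(X_2,d_2)$ be a product of two proper Hadamard spaces with the standard product metric $d$, and let $G\subset Is(X_1)\times Is(X_2)$ be a group acting properly on $X$. Assume that $G$ contains two elements $g=(g_1,g_2)$ and $h=(h_1,h_2)$ such that, for each $i\in\{1,2\}$, $g_i$ and $h_i$ are independent rank one isometries of $X_i$; that $\delta_\gamma>0$ for every $\gamma\in(0,\pi/2)$; and that there exist $\theta,\beta\in(0,\pi/2)$ with $$\frac{\delta_{\pi/2}}{\delta_\theta}<\frac{1}{\sin\theta}\quad\text{and}\quad\frac{\delta_0}{\delta_{\pi/2-\beta}}<\frac{1}{\sin\beta}.$$ Then there exists $\theta_\star\in(0,\pi/2)$ such that $\delta_{\theta_\star}=\max_{\theta\in[0,\pi/2]}\delta_\theta$.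
   Context: A Hadamard space is a complete simply connected metric space of non-positive Alexandrov curvature (a complete CAT(0) space); it is proper if all balls of finite radius are compact. For $(X_1,d_1),(X_2,d_2)$ proper Hadamard spaces, $X=X_1\times X_2$ carries the metric $d=\sqrt{d_1^2+d_2^2}$; $Is(X_i)$ is the isometry group of $X_i$; $o=(o_1,o_2)\in X$ is a fixed base point. A group $G\subset Is(X_1)\times Is(X_2)$ acts properly on $X$ if $\{g\in G: d(x,gx)\le r\}$ is finite for all $x\in X$, $r>0$. An isometry of a Hadamard space is rank one if it acts as a translation on a geodesic axis which does not bound a flat half plane; it then fixes the two endpoints of its axis in the geometric boundary. Two rank one isometries are independent if their sets of fixed boundary endpoints are disjoint. For $g=(g_1,g_2)\in G$ with $go\ne o$ let $\theta(g)=\arctan\frac{d_2(o_2,g_2o_2)}{d_1(o_1,g_1o_1)}\in[0,\pi/2]$ (with value $\pi/2$ if the denominator is $0$). For $\theta\in[0,\pi/2]$, $\epsilon>0$, integer $n\ge1$, put $A_{\epsilon,\theta}(o,n)=\{g\in G: go\neq o,\ n-1\le d(o,go)<n,\ |\theta(g)-\theta|\le\epsilon\}$, $\delta_{\epsilon,\theta}=\limsup_{n\to\infty}\frac{\log|A_{\epsilon,\theta}(o,n)|}{n}$ (with $\log 0=-\infty$), and $\delta_\theta=\liminf_{\epsilon\to0}\delta_{\epsilon,\theta}\in[-\infty,\infty)$. The number $\delta_\theta$ is the growth rate of $G$ with slope $\theta$. *)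

(* Defs.v *)
From HB Require Import structures.
From mathcomp Require Import all_boot all_order all_algebra.
From mathcomp Require Import all_classical all_reals all_analysis.

Set Implicit Arguments.
Unset Strict Implicit.
Unset Printing Implicit Defensive.

Import Order.TTheory GRing.Theory Num.Theory.
Import numFieldNormedType.Exports.

Local Open Scope classical_set_scope.
Local Open Scope ring_scope.

(** * Hadamard spaces *)

Section Euclidean_plane.
Context {R : realType}.

Definition dist2 (u v : R * R) : R :=
  Num.sqrt ((u.1 - v.1) ^+ 2 + (u.2 - v.2) ^+ 2).

(* The affine point (1 - a) u + a v. *)
Definition segment_point (u v : R * R) (a : R) : R * R :=
  (u.1 + a * (v.1 - u.1), u.2 + a * (v.2 - u.2)).

End Euclidean_plane.

Section Hadamard.
Context {R : realType} (X : metricType R).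

(* Only the restriction of [c] to [0, d(x, y)] is meaningful. *)
Definition geodesic_segment (c : R -> X) (x y : X) : Prop :=
  [/\ c 0 = x, c (mdist x y) = y &
      forall s t, 0 <= s <= mdist x y -> 0 <= t <= mdist x y ->
        mdist (c s) (c t) = `|s - t|].

Definition geodesic_space : Prop :=
  forall x y : X, exists c : R -> X, geodesic_segment c x y.

(* Comparison of geodesic triangles with Euclidean ones. Two distinct sides of
   a triangle have a common vertex, called p here, and for two points on one
   side the comparison inequality is an equality. When p = q the only
   comparison point on the side is p' itself, since then s = 0. *)
Definition CAT0_inequality : Prop :=
  forall (p q r : X) (c1 c2 : R -> X),
    geodesic_segment c1 p q -> geodesic_segment c2 p r ->
  forall p' q' r' : R * R,
    dist2 p' q' = mdist p q -> dist2 p' r' = mdist p r ->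
    dist2 q' r' = mdist q r ->
  forall s t : R, 0 <= s <= mdist p q -> 0 <= t <= mdist p r ->
    mdist (c1 s) (c2 t) <=
      dist2 (segment_point p' q' (s / mdist p q))
            (segment_point p' r' (t / mdist p r)).

(* The library's [completeType] requires a pointed type, hence this form. *)
Definition metric_complete : Prop :=
  forall F : set_system X, ProperFilter F -> cauchy F -> exists x : X, F --> x.

Definition Hadamard_space : Prop :=
  [/\ metric_complete, geodesic_space & CAT0_inequality].

Definition proper_space : Prop :=
  forall (x : X) (r : R), compact [set y : X | mdist x y <= r].

(** * Geometric boundary and rank one isometries *)

Definition is_isometry (f : X -> X) : Prop :=
  bijective f /\ forall x y, mdist (f x) (f y) = mdist x y.

Definition geodesic_line (c : R -> X) : Prop :=
  forall s t, mdist (c s) (c t) = `|s - t|.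

(* Values at negative times are irrelevant. *)
Definition geodesic_ray (c : R -> X) : Prop :=
  forall s t, 0 <= s -> 0 <= t -> mdist (c s) (c t) = `|s - t|.

Definition asymptotic (c c' : R -> X) : Prop :=
  exists K : R, forall t, 0 <= t -> mdist (c t) (c' t) <= K.

(* A point of the geometric boundary is a class of asymptotic rays. *)
Definition boundary_point (c : R -> X) : set (R -> X) :=
  [set c' | geodesic_ray c' /\ asymptotic c c'].

Definition bounds_flat_half_plane (c : R -> X) : Prop :=
  exists F : R * R -> X,
    (forall u v, 0 <= u.2 -> 0 <= v.2 -> mdist (F u) (F v) = dist2 u v) /\
    (forall t, F (t, 0) = c t).

Definition rank_one_axis (g : X -> X) (c : R -> X) : Prop :=
  [/\ geodesic_line c,
      exists2 l : R, 0 < l & forall t, g (c t) = c (t + l) &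
      ~ bounds_flat_half_plane c].

Definition rank_one (g : X -> X) : Prop :=
  is_isometry g /\ exists c, rank_one_axis g c.

Definition boundary_endpoints (g : X -> X) : set (set (R -> X)) :=
  [set xi | exists2 c, rank_one_axis g c &
     xi = boundary_point c \/ xi = boundary_point (fun t => c (- t))].

Definition independent_rank_one (g h : X -> X) : Prop :=
  [/\ rank_one g, rank_one h &
      boundary_endpoints g `&` boundary_endpoints h = set0].

End Hadamard.

(** * Groups acting on a product, growth rates *)

Section Product.
Context {R : realType} {X1 X2 : metricType R}.
Implicit Types (x y o : X1 * X2) (g : (X1 -> X1) * (X2 -> X2)).

(* The library's metric on X1 * X2 is the maximum of the two distances. *)
Definition prod_dist x y : R :=
  Num.sqrt (mdist x.1 y.1 ^+ 2 + mdist x.2 y.2 ^+ 2).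

Definition prod_act g x : X1 * X2 := (g.1 x.1, g.2 x.2).

Variable G : set ((X1 -> X1) * (X2 -> X2)).

Definition isometry_group : Prop :=
  [/\ forall g, G g -> is_isometry g.1 /\ is_isometry g.2,
      G (idfun, idfun),
      forall g h, G g -> G h -> G (g.1 \o h.1, g.2 \o h.2) &
      forall g, G g -> exists h, [/\ G h, cancel g.1 h.1 & cancel g.2 h.2]].

Definition acts_properly : Prop :=
  forall x (r : R), 0 < r ->
    finite_set [set g | G g /\ prod_dist x (prod_act g x) <= r].

Variable o : X1 * X2.

Definition slope_angle g : R :=
  let d1 := mdist o.1 (g.1 o.1) in
  let d2 := mdist o.2 (g.2 o.2) in
  if d1 == 0 then pi / 2 else atan (d2 / d1).

Definition slope_annulus (eps theta : R) (n : nat) :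
    set ((X1 -> X1) * (X2 -> X2)) :=
  [set g | [/\ G g, prod_act g o <> o,
               n%:R - 1 <= prod_dist o (prod_act g o) < n%:R &
               `|slope_angle g - theta| <= eps]].

Local Open Scope ereal_scope.

(* [lne 0 = -oo]; the value of the sequence at n = 0 does not affect the upper
   limit. *)
Definition growth_eps (eps theta : R) : \bar R :=
  limn_esup (fun n => lne (counting (slope_annulus eps theta n)) / n%:R%:E).

(* The lower limit is taken as eps tends to 0 through positive values. *)
Definition growth_rate (theta : R) : \bar R :=
  limf_einf (fun eps => growth_eps eps theta) (0%R^'+).

End Product.

(* Main.v *)
Require Import Defs.
From mathcomp Require Import all_boot all_order all_algebra finmap.
From mathcomp Require Import all_classical all_reals all_analysis.
From mathcomp Require Import ring lra zify.

(** Extend the growth rate to a homogeneous function Psi of degree one on the quadrant,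
  whose value at a vector of slope theta is its norm times the growth rate at theta.
  The main point is that Psi is superadditive (growth_rate_superadditive).  Given
  this, suppose that the maximum D of the growth rate is attained at pi / 2.  The
  vector t e_(pi / 2) + e_theta has norm t + sin theta + O(1/t), while Psi is there
  at least t D plus the growth rate of theta, which exceeds D sin theta by
  assumption.  For large t, the growth rate of the slope of this vector is larger
  than D (growth_rate_improves), a contradiction; the end 0 is symmetric.  A maximum
  exists since the growth rate is upper semicontinuous (growth_rate_max).

  Superadditivity comes from generic products (generic_product): for any g, h in G there
  is a connecting element f in a fixed finite set such that, in both factors, the
  geodesic from o to g f h o passes near g o.  Displacements of such products are
  additive up to a constant, and few pairs have the same product (product_count), so
  that words of elements with slopes near alpha and theta are almost as numerous as
  free words (many_products).

  Generic products are found by ping-pong with the two independent rank one pairs.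
  This rests on a contraction property of a rank one axis (fellow_travel): a geodesic
  between points whose feet on the axis are far apart passes near the axis.  It is
  derived from one compactness argument (no_flat_sector).  If the distance to a far
  point x is nearly affine, with slope away from 1 and -1, on a long interval of a
  line, then the geodesics from the points of this interval to x make nearly the same
  angle with the line, and in the limit they fill out a flat half plane.  Since the
  distance to x is convex along the axis, its slope must therefore approach 1 within
  a bounded distance of the foot of x (foot_slope), so that geodesics from far points
  of the axis to x start along the axis; applied with slope 0 to the point of a
  geodesic nearest to the axis, the same argument yields fellow_travel. *)

Set Implicit Arguments.
Unset Strict Implicit.
Unset Printing Implicit Defensive.

Import Order.TTheory GRing.Theory Num.Theory.
Import numFieldNormedType.Exports.

Local Open Scope classical_set_scope.
Local Open Scope ring_scope.

(** * Comparison estimates in a space of nonpositive curvature *)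

Section Comparison.
Context {R : realType} (X : metricType R).
Hypothesis hX : Hadamard_space X.
Implicit Types (p q r x y z : X) (c : R -> X).

Lemma mdist_lipschitz x y z : `|mdist x z - mdist y z| <= mdist x y.
Proof.
have h1 := metric_triangle x y z; have h2 := metric_triangle y x z.
rewrite (metric_sym y x) in h2.
by rewrite ler_norml; apply/andP; split; lra.
Qed.

Lemma cat0_comparison p q r c1 c2 s t :
    geodesic_segment c1 p q -> geodesic_segment c2 p r ->
    0 < mdist p q -> 0 < mdist p r ->
    0 <= s <= mdist p q -> 0 <= t <= mdist p r ->
  mdist (c1 s) (c2 t) ^+ 2 <= (s - t) ^+ 2 +
    s * t * (mdist q r ^+ 2 - (mdist p q - mdist p r) ^+ 2)
      / (mdist p q * mdist p r).
Proof.
move=> g1 g2 A0 B0 hs ht.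
have [_ _ cat0] := hX.
have h1 := metric_triangle q p r; rewrite (metric_sym q p) in h1.
have h2 := metric_triangle p r q; rewrite (metric_sym r q) in h2.
have h3 := metric_triangle p q r.
have D0 := mdist_ge0 q r.
move: h1 h2 h3 D0 A0 B0 (cat0 _ _ _ _ _ g1 g2) hs ht.
set A := mdist p q; set B := mdist p r; set D := mdist q r.
move=> h1 h2 h3 D0 A0 B0 comp hs ht.
pose k := (A ^+ 2 + B ^+ 2 - D ^+ 2) / (2 * A * B).
have AB0 : 0 < 2 * A * B by rewrite !mulr_gt0.
have k1 : k <= 1 by rewrite ler_pdivrMr // mul1r; nra.
have k2 : -1 <= k by rewrite ler_pdivlMr // mulN1r; nra.
pose h := Num.sqrt (1 - k ^+ 2).
have hh : h ^+ 2 = 1 - k ^+ 2 by rewrite sqr_sqrtr //; nra.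
have kAB : 2 * A * B * k = A ^+ 2 + B ^+ 2 - D ^+ 2.
  by rewrite mulrC divfK // gt_eqF.
have dist2E (u v : R * R) a : 0 <= a ->
    (u.1 - v.1) ^+ 2 + (u.2 - v.2) ^+ 2 = a ^+ 2 -> dist2 u v = a.
  by move=> a0 e; rewrite /dist2 e sqrtr_sqr ger0_norm.
have e1 : dist2 (0, 0) (A, 0) = A by apply: dist2E; [exact: ltW|rewrite /=; ring].
have e2 : dist2 (0, 0) (k * B, h * B) = B.
  apply: dist2E; first exact: ltW.
  have -> : (0 - k * B) ^+ 2 + (0 - h * B) ^+ 2 =
    k ^+ 2 * B ^+ 2 + h ^+ 2 * B ^+ 2 by ring.
  by rewrite hh; ring.
have e3 : dist2 (A, 0) (k * B, h * B) = D.
  apply: dist2E => //=.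
  have -> : (A - k * B) ^+ 2 + (0 - h * B) ^+ 2 =
    A ^+ 2 - (2 * A * B * k) + k ^+ 2 * B ^+ 2 + h ^+ 2 * B ^+ 2 by ring.
  by rewrite kAB hh; ring.
have H := comp _ _ _ e1 e2 e3 s t hs ht.
have A1 : A != 0 by rewrite gt_eqF.
have B1 : B != 0 by rewrite gt_eqF.
have := lerXn2r 2 (mdist_ge0 _ _) (sqrtr_ge0 _) H.
rewrite /dist2 sqr_sqrtr; last by rewrite addr_ge0 // sqr_ge0.
move=> /le_trans; apply; rewrite /segment_point /=.
have -> : (0 + s / A * (A - 0) - (0 + t / B * (k * B - 0))) ^+ 2 +
    (0 + s / A * (0 - 0) - (0 + t / B * (h * B - 0))) ^+ 2 =
    s ^+ 2 - 2 * s * t * k + t ^+ 2 * k ^+ 2 + t ^+ 2 * h ^+ 2.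
  by field; rewrite A1 B1.
rewrite hh.
have -> : s * t * (D ^+ 2 - (A - B) ^+ 2) / (A * B) = 2 * s * t * (1 - k).
  by rewrite /k; field; rewrite A1 B1.
by rewrite le_eqVlt; apply/orP; left; apply/eqP; ring.
Qed.

(** In cat0_comparison, the factor s t / (A B) formed with the lengths A and B of the
  sides is at most 1, and tends to 1 as the common vertex recedes.  With 1 in its
  place, the bound depends only on the difference of the two lengths. *)
Lemma cat0_sector p q r c1 c2 a b :
    geodesic_segment c1 p q -> geodesic_segment c2 p r ->
    0 < mdist p q -> 0 < mdist p r ->
    0 <= a <= mdist p q -> 0 <= b <= mdist p r ->
  mdist (c1 (mdist p q - a)) (c2 (mdist p r - b)) ^+ 2 <=
    mdist q r ^+ 2 + (a - b) ^+ 2 - 2 * (a - b) * (mdist p q - mdist p r).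
Proof.
move=> g1 g2 A0 B0 ha hb.
have := mdist_lipschitz q r p; rewrite (metric_sym q p) (metric_sym r p).
have := @cat0_comparison p q r c1 c2 (mdist p q - a) (mdist p r - b) g1 g2 A0 B0.
move: ha hb A0 B0; set A := mdist p q; set B := mdist p r; set D := mdist q r.
move=> ha hb A0 B0 H; rewrite ler_norml => hD.
have {H} := H ltac:(lra) ltac:(lra).
move=> /le_trans; apply.
have E0 : 0 <= D ^+ 2 - (A - B) ^+ 2 by nra.
have : (A - a) * (B - b) * (D ^+ 2 - (A - B) ^+ 2) / (A * B)
    <= D ^+ 2 - (A - B) ^+ 2.
  rewrite ler_pdivrMr ?mulr_gt0 // mulrC ler_wpM2l //.
  by apply: ler_pM; lra.
nra.
Qed.

Lemma geodesic_segment_exists x y : exists c, geodesic_segment c x y.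
Proof. by have [_ h _] := hX; exact: h. Qed.

Lemma geodesic_segment_start c x y : geodesic_segment c x y -> c 0 = x.
Proof. by case. Qed.

Lemma geodesic_segment_end c x y : geodesic_segment c x y -> c (mdist x y) = y.
Proof. by case. Qed.

Lemma mdist_geodesic_start c x y s :
  geodesic_segment c x y -> 0 <= s <= mdist x y -> mdist x (c s) = s.
Proof.
move=> [c0 _ h] hs; rewrite -{1}c0 h //; last by rewrite lexx mdist_ge0.
by rewrite sub0r normrN ger0_norm; lra.
Qed.

Lemma mdist_geodesic_end c x y s :
  geodesic_segment c x y -> 0 <= s <= mdist x y ->
  mdist (c s) y = mdist x y - s.
Proof.
move=> [_ c1 h] hs; rewrite -{1}c1 h //; last by rewrite lexx mdist_ge0.
by rewrite distrC ger0_norm; lra.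
Qed.

Lemma geodesic_segment_rev c x y : geodesic_segment c x y ->
  geodesic_segment (fun t => c (mdist x y - t)) y x.
Proof.
move=> [c0 c1 h]; split; first by rewrite subr0.
  by rewrite (metric_sym y) subrr.
move=> s t; rewrite (metric_sym y) => hs ht.
rewrite h; [|lra|lra].
by rewrite -normrN; congr (`|_|); ring.
Qed.

Lemma geodesic_segment_sub c x y u : geodesic_segment c x y ->
  0 <= u <= mdist x y -> geodesic_segment c x (c u).
Proof.
move=> g hu; have e := mdist_geodesic_start g hu; case: g => c0 _ h.
split; rewrite ?e //.
by move=> s t hs ht; rewrite h //; lra.
Qed.

Lemma cat0_scaled p q r c1 c2 f :
    geodesic_segment c1 p q -> geodesic_segment c2 p r -> 0 <= f <= 1 ->
  mdist (c1 (f * mdist p q)) (c2 (f * mdist p r)) <= f * mdist q r.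
Proof.
move=> g1 g2 hf.
have hA : 0 <= f * mdist p q <= mdist p q by have := mdist_ge0 p q; nra.
have hB : 0 <= f * mdist p r <= mdist p r by have := mdist_ge0 p r; nra.
have [pq|pq] := eqVneq p q.
  rewrite -pq mdistxx mulr0 (geodesic_segment_start g1).
  by rewrite (mdist_geodesic_start g2).
have [pr|pr] := eqVneq p r.
  rewrite -pr mdistxx mulr0 (geodesic_segment_start g2).
  by rewrite metric_sym (mdist_geodesic_start g1) // metric_sym.
rewrite -mdist_gt0 in pq; rewrite -mdist_gt0 in pr.
rewrite -(@ler_pXn2r _ 2%N) ?nnegrE ?mdist_ge0 ?mulr_ge0 ?mdist_ge0 //;
  last by lra.
apply: (le_trans (cat0_comparison g1 g2 pq pr hA hB)).
move: pq pr {hA hB g1 g2}.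
set A := mdist p q; set B := mdist p r; set D := mdist q r => A0 B0.
rewrite le_eqVlt; apply/orP; left; apply/eqP.
by field; rewrite !gt_eqF.
Qed.

(** Stewart's relation, an equality in the Euclidean plane, bounds the distance
  from a vertex to a point of the opposite side. *)
Lemma cat0_stewart p q r c f :
    geodesic_segment c p q -> 0 <= f <= 1 ->
  mdist (c (f * mdist p q)) r ^+ 2 <=
    (1 - f) * mdist p r ^+ 2 + f * mdist q r ^+ 2
      - f * (1 - f) * mdist p q ^+ 2.
Proof.
move=> g1 hf.
have hA : 0 <= f * mdist p q <= mdist p q by have := mdist_ge0 p q; nra.
have [pq|pq] := eqVneq p q.
  rewrite -pq mdistxx mulr0 (geodesic_segment_start g1).
  by rewrite le_eqVlt; apply/orP; left; apply/eqP; ring.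
have [pr|pr] := eqVneq p r.
  rewrite -pr mdistxx metric_sym (mdist_geodesic_start g1) // (metric_sym q).
  by rewrite le_eqVlt; apply/orP; left; apply/eqP; ring.
rewrite -mdist_gt0 in pq; rewrite -mdist_gt0 in pr.
have [c2 g2] := geodesic_segment_exists p r.
have hB : 0 <= mdist p r <= mdist p r by rewrite lexx ltW.
have := cat0_comparison g1 g2 pq pr hA hB.
rewrite (geodesic_segment_end g2) => /le_trans; apply.
move: pq pr {hA hB g1 g2}.
set A := mdist p q; set B := mdist p r; set D := mdist q r => A0 B0.
rewrite le_eqVlt; apply/orP; left; apply/eqP.
by field; rewrite !gt_eqF.
Qed.

(** Applying Stewart's relation at the midpoint of one diagonal, as seen from
  the ends of the other one, compares diagonals and sides. *)
Lemma cat0_quadrilateral w x y z :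
  mdist w y ^+ 2 + mdist x z ^+ 2 <=
  mdist w x ^+ 2 + mdist x y ^+ 2 + mdist y z ^+ 2 + mdist z w ^+ 2.
Proof.
have [k g] := geodesic_segment_exists w y.
have hf : 0 <= (2^-1 : R) <= 1 by lra.
have := cat0_stewart x g hf; have := cat0_stewart z g hf.
set m := k _; have := metric_triangle x m z; rewrite (metric_sym x m).
rewrite (metric_sym y x) (metric_sym w z).
have := mdist_ge0 x z; have := mdist_ge0 m x; have := mdist_ge0 m z.
move: (mdist x z) (mdist m x) (mdist m z) => e f h f0 h0 e0 tri.
have : e ^+ 2 <= 2 * h ^+ 2 + 2 * f ^+ 2.
  have : e ^+ 2 <= (h + f) ^+ 2 by rewrite ler_pXn2r ?nnegrE //; lra.
  have := sqr_ge0 (h - f); nra.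
lra.
Qed.

End Comparison.

(** * Flat half planes as limits of sectors *)

Section FlatHalfPlane.
Context {R : realType} (X : metricType R).
Hypothesis hX : Hadamard_space X.
Variable c : R -> X.
Hypothesis hc : geodesic_line c.

Lemma geodesic_line_segment a b : a <= b ->
  geodesic_segment (fun s => c (a + s)) (c a) (c b).
Proof.
move=> ab; have e : mdist (c a) (c b) = b - a by rewrite hc distrC ger0_norm ?subr_ge0.
split; rewrite ?e ?addr0 //; first by rewrite addrC subrK.
by move=> s t _ _; rewrite hc; congr (`|_|); ring.
Qed.

Variables (lam : R) (F : R -> R -> X).
Hypothesis lam1 : `|lam| < 1.
Hypothesis Fc : forall tau r, 0 <= r -> mdist (F tau r) (c tau) = r.
Let Q (x y : R) := x ^+ 2 + y ^+ 2 - 2 * lam * x * y.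
Hypothesis Fle : forall tau tau' r r', 0 <= r -> 0 <= r' ->
  mdist (F tau r) (F tau' r') ^+ 2 <= Q (tau - tau') (r - r').

Let F0 tau : F tau 0 = c tau.
Proof. by apply: mdist_positivity; exact: Fc. Qed.

Let lam_bounds : -1 < lam < 1.
Proof. by move: lam1; rewrite ltr_norml. Qed.

Let Q_ge0 x y : 0 <= Q x y.
Proof.
rewrite /Q; have -> : x ^+ 2 + y ^+ 2 - 2 * lam * x * y =
  (x - lam * y) ^+ 2 + (1 - lam ^+ 2) * y ^+ 2 by ring.
have := lam_bounds => ?.
by rewrite addr_ge0 ?sqr_ge0 // mulr_ge0 ?sqr_ge0 //; nra.
Qed.

(* The midpoint inequality turns two upper bounds into equalities. *)
Let F_line tau t r : 0 <= r -> mdist (F tau r) (c t) ^+ 2 = Q (tau - t) r.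
Proof.
move=> r0; apply/eqP; rewrite eq_le; apply/andP; split.
  by rewrite -(F0 t); have := Fle tau t r0 (lexx 0); rewrite subr0.
set T := `|tau - t|.
have T0 : 0 <= T by exact: normr_ge0.
have g := @geodesic_line_segment (tau - T) (tau + T) ltac:(lra).
have hf : 0 <= (2^-1 : R) <= 1 by lra.
have := cat0_stewart hX (F tau r) g hf.
have e : mdist (c (tau - T)) (c (tau + T)) = 2 * T.
  by rewrite hc -normrN ger0_norm; lra.
rewrite e.
have -> : c (tau - T + 2^-1 * (2 * T)) = c tau by congr c; field.
rewrite metric_sym Fc // (metric_sym (c (tau - T))) (metric_sym (c (tau + T))).
have u1 := Fle tau (tau - T) r0 (lexx 0).
have u2 := Fle tau (tau + T) r0 (lexx 0).
rewrite !F0 !subr0 in u1 u2.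
move: u1 u2; rewrite /Q /T.
have [tt|tt] := leP t tau.
  rewrite ger0_norm ?subr_ge0 //.
  have -> : tau - (tau - (tau - t)) = tau - t by ring.
  have -> : tau - (tau - t) = t by ring.
  by move: (mdist _ (c t)) (mdist _ (c (_ + _))) => a b; lra.
rewrite ltr0_norm ?subr_lt0 //.
have -> : tau + - (tau - t) = t by ring.
by move: (mdist _ (c t)) (mdist _ (c (_ - _))) => a b; lra.
Qed.

Let N x y := Num.sqrt (Q x y).

Let NZ k x y : 0 <= k -> N (k * x) (k * y) = k * N x y.
Proof.
move=> k0; rewrite /N.
have -> : Q (k * x) (k * y) = k ^+ 2 * Q x y by rewrite /Q; ring.
by rewrite sqrtrM ?sqr_ge0 // sqrtr_sqr ger0_norm.
Qed.

Let F_lineN tau t r : 0 <= r -> mdist (F tau r) (c t) = N (tau - t) r.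
Proof. by move=> r0; rewrite /N -F_line // sqrtr_sqr ger0_norm ?mdist_ge0. Qed.

(* The line of the model half plane through two points at different heights
  meets the boundary, and distances to its boundary point are known. *)
Let F_lt tau tau' r r' : 0 <= r -> r < r' ->
  N (tau' - tau) (r' - r) <= mdist (F tau' r') (F tau r).
Proof.
move=> r0 rr; set k := r / (r' - r).
have k0 : 0 <= k by rewrite divr_ge0 // subr_ge0 ltW.
have rr0 : r' - r != 0 by rewrite gt_eqF // subr_gt0.
have := metric_triangle (F tau' r') (F tau r) (c (tau - k * (tau' - tau))).
rewrite !F_lineN //; last by lra.
have -> : tau' - (tau - k * (tau' - tau)) = (1 + k) * (tau' - tau) by ring.
have -> : tau - (tau - k * (tau' - tau)) = k * (tau' - tau) by ring.
have e1 : r' = (1 + k) * (r' - r) by rewrite /k; field.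
have e2 : r = k * (r' - r) by rewrite /k; field.
have := NZ (tau' - tau) (r' - r) k0; rewrite -e2 => ->.
have := @NZ (1 + k) (tau' - tau) (r' - r) ltac:(lra); rewrite -e1 => ->.
by lra.
Qed.

Let F_dist tau tau' r r' : 0 <= r -> 0 <= r' ->
  mdist (F tau' r') (F tau r) ^+ 2 = Q (tau' - tau) (r' - r).
Proof.
move=> r0 r'0; apply/eqP; rewrite eq_le Fle //=.
suff H : N (tau' - tau) (r' - r) <= mdist (F tau' r') (F tau r).
  by rewrite -(sqr_sqrtr (Q_ge0 _ _)) ler_pXn2r ?nnegrE ?sqrtr_ge0 ?mdist_ge0.
have [rr|rr|rr] := ltgtP r r'; first exact: F_lt.
  rewrite metric_sym; suff -> : N (tau' - tau) (r' - r) = N (tau - tau') (r - r').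
    exact: F_lt.
  by rewrite /N /Q; congr Num.sqrt; ring.
rewrite -rr subrr.
have -> : N (tau' - tau) 0 = `|tau' - tau|.
  rewrite /N /Q -sqrtr_sqr; congr Num.sqrt; ring.
apply/ler_addgt0Pl => e e0.
have e2 : r < r + e / 2 by lra.
have := F_lt tau tau' r0 e2.
have -> : r + e / 2 - r = e / 2 by ring.
have h1 := Fle tau' tau' r0 (ltac:(lra) : 0 <= r + e / 2).
have {}h1 : mdist (F tau' r) (F tau' (r + e / 2)) <= e / 2.
  rewrite -(@ler_pXn2r _ 2%N) ?nnegrE ?mdist_ge0 //; last by lra.
  by apply: le_trans h1 _; rewrite /Q; nra.
rewrite metric_sym in h1.
have h2 := metric_triangle (F tau' (r + e / 2)) (F tau' r) (F tau r).
suff : `|tau' - tau| - e / 2 <= N (tau' - tau) (e / 2) by lra.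
apply: (le_trans (ler_norm _)); rewrite -sqrtr_sqr /N ler_wsqrtr //.
have /andP[l1 l2] := lam_bounds.
have [tt|/ltW tt] := leP 0 (tau' - tau).
  rewrite /Q ger0_norm //; move: (tau' - tau) tt => x tt.
  have := mulr_ge0 (mulr_ge0 tt (ltW e0)) (ltac:(lra) : 0 <= 1 - lam); nra.
rewrite /Q ler0_norm //; move: (tau' - tau) tt => x tt.
have := mulr_ge0 (mulr_ge0 (ltac:(lra) : 0 <= - x) (ltW e0))
  (ltac:(lra) : 0 <= 1 + lam); nra.
Qed.

(** Suppose that points of rays issuing from the line are at most as far apart as
  for parallel rays of a Euclidean half plane.  Then all these bounds are
  equalities, for distances to the line by the midpoint inequality, and for the
  other ones by the triangle inequality along the lines of the model. *)
Lemma flat_half_plane_of_rays : bounds_flat_half_plane c.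
Proof.
have hl := lam_bounds.
have k0 : 0 < 1 - lam ^+ 2 by nra.
pose k := Num.sqrt (1 - lam ^+ 2).
have kp : 0 < k by rewrite sqrtr_gt0.
have k2 : k ^+ 2 = 1 - lam ^+ 2 by rewrite sqr_sqrtr // ltW.
exists (fun u => F (u.1 + lam / k * u.2) (u.2 / k)); split; last first.
  by move=> t /=; rewrite mulr0 addr0 mul0r F0.
move=> u v u0 v0; rewrite /dist2 -[LHS]ger0_norm ?mdist_ge0 // -sqrtr_sqr.
congr Num.sqrt.
rewrite F_dist; [|exact: divr_ge0 v0 (ltW kp)|exact: divr_ge0 u0 (ltW kp)].
rewrite /Q.
have kn : k != 0 by rewrite gt_eqF.
have -> : u.1 + lam / k * u.2 - (v.1 + lam / k * v.2) =
  u.1 - v.1 + lam * ((u.2 - v.2) / k) by field.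
have -> : u.2 / k - v.2 / k = (u.2 - v.2) / k by field.
have -> : (u.2 - v.2) ^+ 2 = ((u.2 - v.2) / k) ^+ 2 * k ^+ 2 by field.
by rewrite k2; ring.
Qed.

End FlatHalfPlane.

(** Limits along one ultrafilter replace the choice of subsequences, and exist at
  all points of the limit half plane simultaneously. *)
Lemma ultra_cvg_compact (T : Type) (Y : topologicalType) (U : set_system T)
    (f : T -> Y) (K : set Y) :
    UltraFilter U -> compact K -> (\forall n \near U, K (f n)) ->
  exists2 p, K p & f @ U --> p.
Proof.
move=> UU cK fK.
have [p [Kp cp]] := cK (f @ U) _ fK.
exists p => // A Ap.
have [//|h] := in_ultra_setVsetC (f @^-1` A) UU.
have /set0P/eqP[] := cp (~` A) A h Ap.
by rewrite setICl.
Qed.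

Section NoFlatSector.
Context {R : realType} (X : metricType R).
Hypothesis (hX : Hadamard_space X) (pX : proper_space X).
Variable c : R -> X.
Hypothesis (hc : geodesic_line c) (flat : ~ bounds_flat_half_plane c).

(** Consider far points whose distance functions are nearly affine on long intervals
  of the line, with slopes away from 1 and -1.  In the limit, the geodesics from the
  points of the line to the far points would form a constant angle with the line,
  and fill out a flat half plane. *)
Lemma no_flat_sector eta : 0 < eta -> exists N : nat, forall x lam,
    `|lam| <= 1 - eta -> N%:R <= mdist x (c 0) ->
  exists2 t, `|t| <= N%:R &
    N.+1%:R^-1 < `|mdist x (c t) - mdist x (c 0) - lam * t|.
Proof.
move=> eta0; apply: contrapT => /forallNP H; apply: flat.
have {H} : forall N : nat, exists xl : X * R, [/\ `|xl.2| <= 1 - eta,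
    N%:R <= mdist xl.1 (c 0) & forall t, `|t| <= N%:R ->
    `|mdist xl.1 (c t) - mdist xl.1 (c 0) - xl.2 * t| <= N.+1%:R^-1].
  move=> N; have /existsNP[x /existsNP[lam]] := H N.
  move=> /not_implyP[l1 /not_implyP[l2 l3]].
  exists (x, lam); split => // t tN; rewrite leNgt; apply/negP => h.
  by apply: l3; exists t.
move=> /choice[xl hxl].
pose x n := (xl n).1; pose l n := (xl n).2.
have l1 n : `|l n| <= 1 - eta by have [] := hxl n.
have D0 n : n%:R <= mdist (x n) (c 0) by have [] := hxl n.
have aff n t : `|t| <= n%:R ->
    `|mdist (x n) (c t) - mdist (x n) (c 0) - l n * t| <= n.+1%:R^-1.
  by have [_ _] := hxl n; exact.
have [U [UU ooU]] := ultraFilterLemma (@eventually_filter : ProperFilter \oo).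
have Uge (a : R) : \forall n \near U, a <= n%:R.
  by apply: ooU; exact: nbhs_infty_ger.
have Dge n t : n%:R - `|t| <= mdist (x n) (c t).
  have := metric_triangle (x n) (c t) (c 0); rewrite hc subr0.
  by have := D0 n; lra.
have [lam llam] : exists lam : R, l @ U --> lam.
  suff [p _ lp] : exists2 p : R, `[-1, 1]%classic p & l @ U --> p by exists p.
  apply: ultra_cvg_compact; first exact: segment_compact.
  apply: nearW => n; rewrite /= in_itv /=.
  by have := l1 n; rewrite ler_norml; lra.
have lam1 : `|lam| <= 1 - eta.
  apply/ler_addgt0Pl => e e0.
  have /filter_ex[n hn] : \forall n \near U, `|lam - l n| < e.
    exact: (@cvgr_dist_lt R R^o _ _ _ l lam llam _ e0).
  have := l1 n; have := ler_normD (lam - l n) (l n).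
  by rewrite subrK; lra.
have : forall n, exists s : R -> R -> X,
    forall t, geodesic_segment (s t) (c t) (x n).
  by move=> n; have /choice[f hf] := fun t => geodesic_segment_exists hX (c t) (x n); exists f.
move=> /choice[s hs].
have sD t r n : 0 <= r -> r + `|t| <= n%:R -> 0 <= r <= mdist (c t) (x n).
  by move=> r0 rn; have := Dge n t; rewrite metric_sym; lra.
have : forall tr : R * R, exists z : X,
    0 <= tr.2 -> (fun n => s n tr.1 tr.2) @ U --> z.
  move=> [t r] /=; have [r0|] := leP 0 r; last by exists (c 0).
  have [] := @ultra_cvg_compact _ _ U (fun n => s n t r)
    [set y | mdist (c t) y <= r] UU; [exact: pX| |by move=> z _ hz; exists z].
  apply: filterS (Uge (r + `|t|)) => n rn /=.
  by rewrite (mdist_geodesic_start (hs n t)) //; exact: sD.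
move=> /choice[F0 hF0].
pose F t r := F0 (t, r).
have hF t r e : 0 <= r -> 0 < e -> \forall n \near U, mdist (F t r) (s n t r) < e.
  by move=> r0 e0; apply: (@metricType_numDomainType.cvgr_dist_lt R X _ U _ _ _ (hF0 (t, r) r0)).
apply: (@flat_half_plane_of_rays R X hX c hc lam F); first by lra.
  move=> t r r0; apply/eqP; rewrite eq_le; apply/andP; split;
    apply/ler_addgt0Pl => e e0; have /filter_ex[n [h1 h2]] : \forall n \near U,
      mdist (F t r) (s n t r) < e /\ r + `|t| <= n%:R.
  - by near=> n; split; near: n; [exact: hF|exact: Uge].
  - have := mdist_geodesic_start (hs n t) (sD t r n r0 h2).
    have := metric_triangle (F t r) (s n t r) (c t).
    by rewrite (metric_sym (c t)) => *; lra.
  - by near=> n; split; near: n; [exact: hF|exact: Uge].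
  - have := mdist_geodesic_start (hs n t) (sD t r n r0 h2).
    have := metric_triangle (s n t r) (F t r) (c t).
    by rewrite (metric_sym (c t)) (metric_sym _ (F t r)) => *; lra.
move=> t t' r r' r0 r'0.
set q := (_ ^+ 2 + _ ^+ 2 - _).
pose B := `|t - t'| + r + r'.
pose K := 5 + 4 * B + 2 * `|r - r'| * (1 + `|t - t'|).
have B0 : 0 <= B by rewrite !addr_ge0.
have K0 : 0 < K.
  suff : 0 <= 2 * `|r - r'| * (1 + `|t - t'|) by rewrite /K; lra.
  by rewrite !mulr_ge0 // addr_ge0.
apply/ler_addgt0Pl => e0 e0p.
pose e := Num.min 1 (e0 / K).
have e_gt0 : 0 < e by rewrite lt_min ltr01 divr_gt0.
have e_le1 : e <= 1 by rewrite ge_min lexx.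
have eK : e * K <= e0 by rewrite -ler_pdivlMr // ge_min lexx orbT.
(* An index at which all limits are reached up to e. *)
have /filter_ex[n [[h1 h2] [h3 h4] h5]] : \forall n \near U,
    [/\ mdist (F t r) (s n t r) < e /\ mdist (F t' r') (s n t' r') < e,
        `|lam - l n| < e /\ 2 / e <= n%:R & 1 + r + `|t| + (r' + `|t'|) <= n%:R].
  near=> n; split; [split|split|]; near: n;
    [exact: hF|exact: hF|
     exact: (@cvgr_dist_lt R R^o _ _ _ l lam llam)|exact: Uge|exact: Uge].
have := normr_ge0 t; have := normr_ge0 t' => t'0 t0.
have A0 : 0 < mdist (x n) (c t) by have := Dge n t; lra.
have A'0 : 0 < mdist (x n) (c t') by have := Dge n t'; lra.
have hr : 0 <= r <= mdist (x n) (c t) by have := Dge n t; lra.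
have hr' : 0 <= r' <= mdist (x n) (c t') by have := Dge n t'; lra.
have := cat0_sector hX (geodesic_segment_rev (hs n t))
  (geodesic_segment_rev (hs n t')) A0 A'0 hr hr'.
rewrite (metric_sym (c t)) (metric_sym (c t') (x n)) !subKr hc real_normK ?num_real //.
set dn := mdist (s n t r) _ => sector.
have dnB : dn <= B.
  have := metric_triangle (s n t r) (c t) (s n t' r').
  have := metric_triangle (c t) (c t') (s n t' r').
  rewrite hc (metric_sym _ (c t)).
  rewrite (mdist_geodesic_start (hs n t)); last by rewrite metric_sym.
  rewrite (mdist_geodesic_start (hs n t')); last by rewrite metric_sym.
  by rewrite /B -/dn; lra.
have slope : `|mdist (x n) (c t) - mdist (x n) (c t') - lam * (t - t')|
    <= e * (1 + `|t - t'|).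
  have a1 := aff n t ltac:(lra); have a2 := aff n t' ltac:(lra).
  have n1 : n.+1%:R^-1 <= e / 2.
    have -> : e / 2 = (2 / e)^-1 by rewrite invf_div.
    rewrite lef_pV2 ?posrE ?divr_gt0 // -natr1; lra.
  have a3 : `|(l n - lam) * (t - t')| <= e * `|t - t'|.
    by rewrite normrM ler_wpM2r // distrC ltW.
  move: a1 a2 a3 n1; move: (n.+1%:R^-1) => i.
  by rewrite !ler_norml => /andP[? ?] /andP[? ?] /andP[? ?] ?; apply/andP; split; lra.
have dn2 : dn ^+ 2 <= q + 2 * `|r - r'| * (e * (1 + `|t - t'|)).
  apply: le_trans sector _; rewrite /q.
  have := ler_wpM2l (normr_ge0 (r - r')) slope; rewrite -normrM ler_norml.
  lra.
have tri : mdist (F t r) (F t' r') <= dn + 2 * e.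
  have := metric_triangle (F t r) (s n t r) (F t' r').
  have := metric_triangle (s n t r) (s n t' r') (F t' r').
  by rewrite (metric_sym (s n t' r') (F t' r')) -/dn; lra.
have : mdist (F t r) (F t' r') ^+ 2 <= (dn + 2 * e) ^+ 2.
  have dn_ge0 : 0 <= dn by exact: mdist_ge0.
  by rewrite ler_pXn2r ?nnegrE ?mdist_ge0 //; lra.
move=> /le_trans; apply.
apply: (@le_trans _ _ (q + e * K)); last by rewrite addrC lerD2r.
have dn0 : 0 <= dn by exact: mdist_ge0.
have ee : e * e <= e by rewrite ger_pMr.
have edn : e * dn <= e * B by rewrite ler_pM2l.
have : (dn + 2 * e) ^+ 2 = dn ^+ 2 + 4 * (e * dn) + 4 * (e * e) by ring.
rewrite /K; lra.
Unshelve. all: by end_near. Qed.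

End NoFlatSector.

(** * Distance functions along a rank one axis *)

Definition convex_on_line {R : realType} (f : R -> R) : Prop :=
  forall u v w, u <= v -> v <= w -> (w - u) * f v <= (w - v) * f u + (v - u) * f w.

Section ConvexOnLine.
Context {R : realType} (f : R -> R).
Hypothesis hf : convex_on_line f.

Lemma convex_chords a b c d : a < b -> b <= c -> c < d ->
  (f b - f a) / (b - a) <= (f d - f c) / (d - c).
Proof.
move=> ab bc cd.
rewrite ler_pdivrMr ?subr_gt0 // mulrAC ler_pdivlMr ?subr_gt0 //.
have [bc0|bc0] := eqVneq b c.
  by have := hf (ltW ab) (ltac:(lra) : b <= d); subst c; nra.
have bc1 : 0 < c - b by rewrite subr_gt0 lt_neqAle bc0.
have h1 := hf (ltW ab) bc; have h2 := hf bc (ltW cd).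
have h3 : (f b - f a) * (c - b) <= (f c - f b) * (b - a) by nra.
have h4 : (f c - f b) * (d - c) <= (f d - f c) * (c - b) by nra.
rewrite -(ler_pM2r bc1).
have := ler_wpM2r (ltac:(lra) : 0 <= d - c) h3.
have := ler_wpM2r (ltac:(lra) : 0 <= b - a) h4.
nra.
Qed.

(** A convex function is nearly affine where its slopes hardly vary; this is how a
  pigeonhole on slopes produces the situation excluded by no_flat_sector. *)
Lemma convex_second_difference a m t : 0 < m -> `|t| <= m ->
  `|f (a + t) - f a - (f a - f (a - m)) / m * t| <=
    f (a + m) - 2 * f a + f (a - m).
Proof.
move=> m0 tm.
set k := (f a - f (a - m)) / m.
have km : k * m = f a - f (a - m) by rewrite /k divfK // gt_eqF.
have w0 : 0 <= f (a + m) - 2 * f a + f (a - m).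
  have := @hf (a - m) a (a + m) ltac:(lra) ltac:(lra); nra.
move: tm; rewrite !ler_norml => /andP[t1 t2].
suff : - (m * (f (a + m) - 2 * f a + f (a - m))) <=
      m * (f (a + t) - f a - k * t) /\
    m * (f (a + t) - f a - k * t) <= m * (f (a + m) - 2 * f a + f (a - m)).
  by rewrite -mulrN !ler_pM2l // => -[-> ->].
have -> : m * (f (a + t) - f a - k * t) = m * f (a + t) - m * f a - k * m * t.
  by ring.
rewrite km; have [t0|/ltW t0] := leP 0 t.
  have h1 := @hf a (a + t) (a + m) ltac:(lra) ltac:(lra).
  have h2 := @hf (a - m) a (a + t) ltac:(lra) ltac:(lra).
  by split; nra.
have h1 := @hf (a - m) (a + t) a ltac:(lra) ltac:(lra).
have h2 := @hf (a + t) a (a + m) ltac:(lra) ltac:(lra).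
by split; nra.
Qed.

End ConvexOnLine.

Section MinimumOfDistance.
Context {R : realType} (X : metricType R).

Lemma lipschitz_continuous (f : R -> R) :
  (forall s t, `|f s - f t| <= `|s - t|) -> continuous f.
Proof.
move=> lf t; apply/(@cvgrPdist_lt R R^o) => e e0; 
have := @nbhsx_ballx R R^o t e e0; apply: filterS => s ts.
exact: le_lt_trans (lf _ _) ts.
Qed.

Lemma nearest_point_on_arc (x : X) (c : R -> X) a b : a <= b ->
    (forall s t, a <= s <= b -> a <= t <= b -> mdist (c s) (c t) <= `|s - t|) ->
  exists2 s, a <= s <= b & forall t, a <= t <= b -> mdist x (c s) <= mdist x (c t).
Proof.
move=> ab lc.
(* Clamping the time gives a function which is continuous on the whole line. *)
pose k t := Num.max a (Num.min t b).
have kid t : a <= t <= b -> k t = t.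
  by move=> /andP[ta tb]; rewrite /k min_l ?max_r.
have kP t : [\/ t < a /\ k t = a, a <= t <= b /\ k t = t | b < t /\ k t = b].
  have [ta|ta] := ltP t a.
    by apply: Or31; split=> //; rewrite /k min_l ?max_l //; lra.
  have [tb|tb] := leP t b; first by apply: Or32; split=> //; apply: kid; lra.
  by apply: Or33; split=> //; rewrite /k min_r ?max_r //; lra.
have kab t : a <= k t <= b by have [[]|[]|[]] := kP t; lra.
have kmono s t : s <= t -> 0 <= k t - k s <= t - s.
  by have [[]|[]|[]] := kP s; have [[]|[]|[]] := kP t; lra.
have kl s t : `|k s - k t| <= `|s - t|.
  have [st|/ltW st] := leP s t; have := kmono _ _ st => h.
    by rewrite distrC (distrC s) !ger0_norm; lra.
  by rewrite !ger0_norm; lra.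
have [] := @EVT_min R (fun t => mdist x (c (k t))) a b ab.
  apply: continuous_subspaceT; apply: lipschitz_continuous => s t.
  apply: le_trans (kl s t); apply: le_trans (lc _ _ (kab s) (kab t)).
  by rewrite !(metric_sym x); exact: mdist_lipschitz.
move=> s; rewrite in_itv /= => hs H; exists s => // t ht.
by have := H t; rewrite in_itv /= !kid // => /(_ ht).
Qed.

Definition foot (c : R -> X) (x : X) (s : R) : Prop :=
  forall t, mdist x (c s) <= mdist x (c t).

Lemma foot_exists (c : R -> X) x : geodesic_line c -> exists s, foot c x s.
Proof.
move=> hc; pose K := 2 * mdist x (c 0).
have K0 : 0 <= K by rewrite mulr_ge0 // mdist_ge0.
have [s hs H] := @nearest_point_on_arc x c (- K) K ltac:(lra)
  (fun s t _ _ => ltac:(by rewrite hc)).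
exists s => t.
have [ht|ht] := boolP (- K <= t <= K); first exact: H.
apply: (le_trans (H 0 _)); first by lra.
have := metric_triangle (c 0) x (c t); rewrite hc sub0r normrN.
rewrite (metric_sym _ x); suff : K <= `|t| by rewrite /K; lra.
by move: ht; rewrite -ler_norml -ltNge => /ltW.
Qed.

Lemma foot_isometry (c : R -> X) (f : X -> X) (l : R) x s :
    (forall y z, mdist (f y) (f z) = mdist y z) ->
    (forall t, f (c t) = c (t + l)) -> foot c x s -> foot c (f x) (s + l).
Proof.
move=> fi fc h t; have -> : c t = f (c (t - l)) by rewrite fc subrK.
by rewrite -fc !fi.
Qed.

Lemma foot_opp (c : R -> X) x s : foot c x s -> foot (fun t => c (- t)) x (- s).
Proof. by move=> h t /=; rewrite opprK. Qed.

End MinimumOfDistance.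

(** An axis of some rank one isometry.  The isometry is hidden so that the same
  statements apply to the reversed line, an axis of the inverse. *)
Definition rank_one_line {R : realType} (X : metricType R) (c : R -> X) : Prop :=
  [/\ geodesic_line c,
      exists2 f : X -> X, is_isometry f &
        exists2 l : R, 0 < l & forall t, f (c t) = c (t + l) &
      ~ bounds_flat_half_plane c].

Section RankOneLine.
Context {R : realType} (X : metricType R).
Hypothesis (hX : Hadamard_space X) (pX : proper_space X).
Variable c : R -> X.
Hypothesis rk : rank_one_line c.

Let hc : geodesic_line c. Proof. by case: rk. Qed.

Lemma rank_one_line_rev : rank_one_line (fun t => c (- t)).
Proof.
have [_ [f [[g fg gf] fi] [l l0 fc]] flat] := rk; split.
- by move=> s t; rewrite hc -normrN; congr (`|_|); ring.
- exists g.
    split; first by exists f.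
    by move=> x y; rewrite -fi !gf.
  exists l => // t; rewrite -(fg (c (- (t + l)))) fc.
  by congr (g (c _)); ring.
- move=> [F [F1 F2]]; apply: flat; exists (fun u => F (- u.1, u.2)); split.
    move=> u v u0 v0; rewrite F1 // /dist2 /=; congr Num.sqrt; ring.
  by move=> t; rewrite F2 opprK.
Qed.

Lemma mdist_line_convex x : convex_on_line (fun t => mdist x (c t)).
Proof.
move=> u v w uv vw.
have [uw|uw] := eqVneq u w.
  have -> : v = u by lra.
  by rewrite uw; lra.
have uw0 : 0 < w - u by rewrite subr_gt0 lt_neqAle uw (le_trans uv).
have g := geodesic_line_segment hc (le_trans uv vw).
have hf : 0 <= (v - u) / (w - u) <= 1.
  by rewrite divr_ge0 ?subr_ge0 ?(le_trans uv) //= ler_pdivrMr //; lra.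
have := cat0_stewart hX x g hf.
have := mdist_lipschitz (c u) (c w) x.
have -> : mdist (c u) (c w) = w - u by rewrite hc distrC ger0_norm // ltW.
rewrite divfK ?gt_eqF // (addrC u) subrK -!(metric_sym x) ler_norml.
set f := (v - u) / (w - u) in hf *.
have fw : f * (w - u) = v - u by rewrite divfK // gt_eqF.
have := mdist_ge0 x (c u); have := mdist_ge0 x (c w); have := mdist_ge0 x (c v).
move: (mdist x (c u)) (mdist x (c v)) (mdist x (c w)) => A B C B0 C0 A0 AC H.
have -> : w - v = (1 - f) * (w - u) by rewrite mulrBl fw; ring.
rewrite -fw.
suff : B <= (1 - f) * A + f * C by move=> h; have := ler_wpM2l (ltW uw0) h; lra.
rewrite -(@ler_pXn2r _ 2%N) ?nnegrE //; last by rewrite addr_ge0 // mulr_ge0 //; lra.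
apply: (le_trans H).
have : (A - C) ^+ 2 <= (w - u) ^+ 2 by nra.
have f0 : 0 <= f * (1 - f) by rewrite mulr_ge0 //; lra.
move=> /(ler_wpM2l f0).
lra.
Qed.

Lemma foot_nondecreasing x s u v : foot c x s -> s <= u -> u <= v ->
  mdist x (c u) <= mdist x (c v).
Proof.
move=> h su uv; have [sv|sv] := eqVneq s v.
  by have -> : u = v by lra.
have sv0 : 0 < v - s by rewrite subr_gt0 lt_neqAle sv (le_trans su).
have h1 := mdist_line_convex x su uv; have h2 := h v.
by rewrite -(ler_pM2l sv0); nra.
Qed.

Lemma foot_half_distance x s u : foot c x s -> `|u - s| <= 2 * mdist x (c u).
Proof.
move=> h; rewrite -hc; have := metric_triangle (c u) x (c s).
by rewrite (metric_sym _ x); have := h u; lra.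
Qed.

Let recenter : exists2 l, 0 < l & forall a, exists2 f : X -> X,
    (forall x y, mdist (f x) (f y) = mdist x y) &
    exists2 b, 0 <= b <= l & forall t, f (c (a + t)) = c (b + t).
Proof.
have [_ [f [[g fg gf] fi] [l l0 fc]] _] := rk.
exists l => // a.
pose n := Num.bound (- a / l).
have an : 0 <= a + n%:R * l.
  have [a0|/ltW a0] := leP 0 a; first by rewrite addr_ge0 // mulr_ge0 // ltW.
  have q0 : 0 <= - a / l by apply: divr_ge0 (ltW l0); lra.
  by have := archi_boundP q0; rewrite ltr_pdivrMr // -/n; lra.
pose k := Num.truncn ((a + n%:R * l) / l).
have /andP[k1 k2] : k%:R <= (a + n%:R * l) / l < k.+1%:R.
  by apply: truncn_itv; exact: divr_ge0 an (ltW l0).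
rewrite ler_pdivlMr // in k1; rewrite ltr_pdivrMr // -natr1 in k2.
have gi x y : mdist (g x) (g y) = mdist x y by rewrite -fi !gf.
have gc t : g (c t) = c (t - l) by rewrite -[in LHS](subrK l t) -fc fg.
exists (fun x => iter k g (iter n f x)).
  have it (h : X -> X) m x y : (forall x y, mdist (h x) (h y) = mdist x y) ->
      mdist (iter m h x) (iter m h y) = mdist x y.
    by move=> hi; elim: m => //= m; rewrite hi.
  by move=> x y; rewrite !it.
exists (a + n%:R * l - k%:R * l); first by lra.
move=> t.
have -> : iter n f (c (a + t)) = c (a + t + n%:R * l).
  elim: (n) => [|m IH] /=; first by rewrite mul0r addr0.
  by rewrite IH fc -natr1; congr c; ring.
have -> : a + n%:R * l - k%:R * l + t = a + t + n%:R * l - k%:R * l by ring.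
elim: (k) => [|m IH] /=; first by rewrite mul0r subr0.
by rewrite IH gc -natr1; congr c; ring.
Qed.

(** By periodicity, the scale at which far points fail to see an affine distance
  function is the same along the whole axis. *)
Lemma no_flat_sector_uniform eta : 0 < eta -> exists m e, [/\ 0 < m, 0 < e &
  forall a x lam, `|lam| <= 1 - eta -> m <= mdist x (c a) ->
  exists2 t, `|t| <= m & e < `|mdist x (c (a + t)) - mdist x (c a) - lam * t|].
Proof.
move=> eta0; have [_ _ flat] := rk.
have [N HN] := no_flat_sector hX pX hc flat eta0.
have [l l0 rec] := recenter.
have N0 : 0 <= N%:R :> R by rewrite ler0n.
exists (N%:R + 1 + l), (N.+1%:R^-1 / 2); split; first by lra.
  by rewrite divr_gt0 // invr_gt0.
move=> a x lam hlam hD; apply: contrapT => H.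
have {}H t : `|t| <= N%:R + 1 + l ->
    `|mdist x (c (a + t)) - mdist x (c a) - lam * t| <= N.+1%:R^-1 / 2.
  by move=> ht; rewrite leNgt; apply/negP => h; apply: H; exists t.
have [f fi [b hb fc]] := rec a.
have D t : mdist (f x) (c t) = mdist x (c (a + (t - b))).
  by rewrite -(fi x) fc (addrC b) subrK.
have [] := HN (f x) lam hlam.
  have := metric_triangle (f x) (c 0) (c b); rewrite hc sub0r normrN ger0_norm; last by lra.
  by rewrite (D b) subrr addr0; lra.
move=> t ht; rewrite !D.
have := H (t - b); have := H (0 - b).
have tb : `|t - b| <= N%:R + 1 + l.
  by apply: (le_trans (ler_normB _ _)); rewrite (ger0_norm (_ : 0 <= b)); lra.
have bl : `|0 - b| <= N%:R + 1 + l by rewrite sub0r normrN ger0_norm; lra.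
move=> /(_ bl) + /(_ tb); rewrite !ler_norml ltr_normr.
move: (N.+1%:R^-1) (mdist _ _) (mdist _ _) (mdist _ _) => i A B C.
by move=> /andP[? ?] /andP[? ?] /orP[?|?]; lra.
Qed.

(** The slopes of the distance to a point increase along the axis and lie in
  [0, 1] beyond the foot of the point.  As long as they stay below 1 - eta,
  they are nearly constant on some long interval, unless this part of the axis
  is short. *)
Lemma foot_slope eta m0 : 0 < eta < 1 -> 0 < m0 -> exists2 M, 0 <= M &
  forall x s t, foot c x s -> s + M <= t ->
  (1 - eta) * m0 <= mdist x (c t) - mdist x (c (t - m0)).
Proof.
move=> /andP[eta0 eta1] m00.
have [m [e [mp ep H]]] := no_flat_sector_uniform eta0.
(* There are J + 1 windows of length m before t - m0, and the increment of the
  distance grows by more than e from each window to the next. *)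
pose J := Num.bound (m / e).
have Jm : m < J%:R * e.
  by rewrite -ltr_pdivrMr //; apply: archi_boundP; exact: divr_ge0 (ltW mp) (ltW ep).
have J0 : 0 <= J%:R :> R by rewrite ler0n.
exists (m0 + (J%:R + 1) * m + 2 * m); first by nra.
move=> x s t ft st; rewrite leNgt; apply/negP => lt_slope.
pose D t := mdist x (c t).
have convD : convex_on_line D by exact: mdist_line_convex.
pose u j := t - m0 - (J%:R + 1) * m + j%:R * m.
have u_ge j : s + 2 * m <= u j.
  have : 0 <= j%:R * m by rewrite mulr_ge0 // ltW.
  by rewrite /u; lra.
have uS j : u j.+1 = u j + m by rewrite /u -natr1; ring.
pose d j := D (u j + m) - D (u j).
have d0 j : 0 <= d j.
  rewrite subr_ge0; apply: (foot_nondecreasing ft).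
    by have := u_ge j; lra.
  by lra.
have dle j : (j <= J)%N -> d j < (1 - eta) * m.
  move=> jJ; have jJ' : j%:R <= J%:R :> R by rewrite ler_nat.
  have ut : u j + m <= t - m0 by rewrite /u; nra.
  have := convex_chords convD (ltac:(lra) : u j < u j + m) ut
    (ltac:(lra) : t - m0 < t).
  have -> : u j + m - u j = m by ring.
  have -> : t - (t - m0) = m0 by ring.
  rewrite ler_pdivrMr // -/(d j) => /le_lt_trans; apply.
  by rewrite ltr_pM2r // ltr_pdivrMr.
have step j : (j < J)%N -> d j + e < d j.+1.
  move=> jJ; have slope : `|d j / m| <= 1 - eta.
    rewrite ger0_norm ?divr_ge0 ?d0 1?ltW // ltr_pdivrMr //.
    by apply: dle; exact: ltnW.
  have far : m <= mdist x (c (u j + m)).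
    have h1 := foot_half_distance (u j + m) ft; have h2 := u_ge j.
    by rewrite ger0_norm in h1; lra.
  have [tau htau] := H (u j + m) x _ slope far.
  move=> /lt_le_trans => /(_ _ (_ : _ <= d j.+1 - d j)).
  suff h : `|D (u j + m + tau) - D (u j + m) - d j / m * tau| <= d j.+1 - d j.
    by move=> /(_ h); lra.
  have := convex_second_difference convD (u j + m) mp htau.
  rewrite addrK -/(d j) => /le_trans; apply.
  by rewrite /d uS; lra.
have : forall j, (j <= J)%N -> j%:R * e <= d j.
  elim=> [|j IH] jJ; first by rewrite mul0r.
  by have := IH (ltnW jJ); have := step j jJ; rewrite -natr1; lra.
move=> /(_ J (leqnn J)); have := dle J (leqnn J).
have : 0 < eta * m by rewrite mulr_gt0.
lra.
Qed.

End RankOneLine.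

(** * Geodesics follow rank one axes *)

Section FellowTravel.
Context {R : realType} (X : metricType R).
Hypothesis (hX : Hadamard_space X) (pX : proper_space X).

Section OneAxis.
Variable c : R -> X.
Hypothesis rk : rank_one_line c.

Let hc : geodesic_line c. Proof. by case: rk. Qed.

(** Slope nearly 1 means that the comparison angle at the point of the axis is
  nearly 0, so that the geodesic to a distant point leaves it along the axis. *)
Lemma geodesic_starts_along_axis m e : 0 < m -> 0 < e -> exists2 M, 0 <= M &
  forall x s t k, foot c x s -> s + M <= t -> geodesic_segment k x (c t) ->
  m <= mdist x (c t) /\ mdist (k (mdist x (c t) - m)) (c (t - m)) <= e.
Proof.
(* A deficit eta of the slope moves the point by at most m sqrt (2 eta). *)
move=> m0 e0; pose eta := Num.min 2^-1 (e ^+ 2 / (2 * m ^+ 2)).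
have eta0 : 0 < eta.
  by rewrite lt_min invr_gt0 ltr0n divr_gt0 ?mulr_gt0 ?exprn_gt0.
have eta12 : eta <= 2^-1 by rewrite ge_min lexx.
have etam : 2 * eta * m ^+ 2 <= e ^+ 2.
  rewrite -mulrA mulrCA -ler_pdivlMr ?mulr_gt0 ?exprn_gt0 //.
  by rewrite ge_min lexx orbT.
have [M M0 slope] := @foot_slope R X hX pX c rk eta m ltac:(lra) m0.
exists (M + 2 * m) => [|x s t k ft st g]; first by lra.
have far : m <= mdist x (c t).
  by have := foot_half_distance rk t ft; rewrite ger0_norm; lra.
have sl := slope x s t ft ltac:(lra).
split=> //; rewrite -(@ler_pXn2r _ 2%N) ?nnegrE ?mdist_ge0 ?(ltW e0) //.
apply: le_trans etam.
have D0 : 0 < mdist x (c t) by lra.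
have hf : 0 <= m / mdist x (c t) <= 1.
  by rewrite divr_ge0 ?mdist_ge0 ?(ltW m0) //= ler_pdivrMr // mul1r.
have := cat0_stewart hX (c (t - m)) (geodesic_segment_rev g) hf.
rewrite (metric_sym (c t) x) divfK ?gt_eqF // hc.
have -> : t - (t - m) = m by ring.
have fD : m / mdist x (c t) * mdist x (c t) = m by rewrite divfK // gt_eqF.
rewrite (gtr0_norm m0); move: fD hf sl D0; set f := m / _; have := mdist_ge0 x (c (t - m)).
move: (mdist x (c t)) (mdist x (c (t - m))) => A B B0 fD hf sl D0 /le_trans; apply.
have BB : B ^+ 2 <= (A - (1 - eta) * m) ^+ 2.
  by rewrite ler_pXn2r ?nnegrE //; lra.
have f0 : 0 <= f by lra.
have := ler_wpM2l f0 BB.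
have -> : f * (A - (1 - eta) * m) ^+ 2 = f * A * A - 2 * (f * A) * (1 - eta) * m
  + f * ((1 - eta) * m) ^+ 2 by ring.
have -> : f * (1 - f) * A ^+ 2 = f * A * A - (f * A) ^+ 2 by ring.
rewrite fD.
have : 0 <= f * (m ^+ 2 * (1 - (1 - eta) ^+ 2)).
  have -> : 1 - (1 - eta) ^+ 2 = eta * (2 - eta) by ring.
  by apply: mulr_ge0 f0 _; apply: mulr_ge0 (sqr_ge0 _) _; apply: mulr_ge0; lra.
lra.
Qed.

(** The geodesics from x to c t and to k u stay together, and the first one ends along
  the axis.  The quadrilateral inequality then shows that k u, if it is the point
  of k nearest to c t, is hardly farther from c (t - m) than from c t. *)
Lemma nearest_point_backward m e : 0 < m -> 0 < e -> exists2 M, 0 <= M &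
  forall x y s t k u, foot c x s -> s + M <= t -> geodesic_segment k x y ->
  0 <= u <= mdist x y ->
  (forall v, 0 <= v <= mdist x y -> mdist (c t) (k u) <= mdist (c t) (k v)) ->
  mdist (k u) (c (t - m)) ^+ 2 <= (mdist (c t) (k u) + e) ^+ 2 + 5 * m ^+ 2.
Proof.
move=> m0 e0; have [M M0 along] := geodesic_starts_along_axis m0 e0.
exists M => // x y s t k u ft st gk hu near_u.
have [k' gk'] := geodesic_segment_exists hX x (c t).
have [far close] := along x s t k' ft st gk'.
have D0 : 0 < mdist x (c t) by lra.
set r := mdist (c t) (k u) in near_u *.
have r0 : 0 <= r by exact: mdist_ge0.
pose f := 1 - m / mdist x (c t).
have hf : 0 <= f <= 1.
  have : 0 <= m / mdist x (c t) <= 1.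
    by rewrite divr_ge0 ?mdist_ge0 ?(ltW m0) //= ler_pdivrMr // mul1r.
  by rewrite /f; lra.
have fD : f * mdist x (c t) = mdist x (c t) - m.
  by rewrite /f mulrBl mul1r divfK // gt_eqF.
have xu := mdist_geodesic_start gk hu.
have gku := geodesic_segment_sub gk hu.
have sc := cat0_scaled hX gk' gku hf.
rewrite fD xu -/r in sc.
have fu : 0 <= f * u <= mdist x y by nra.
have rD : r <= mdist x (c t).
  have := near_u 0; rewrite lexx mdist_ge0 => /(_ isT).
  by rewrite (geodesic_segment_start gk) metric_sym.
have uD : u <= mdist x (c t) + r by rewrite -{1}xu; exact: metric_triangle.
have wp : mdist (k u) (k (f * u)) <= 2 * m.
  have [_ _ ->] := gk => //.
  rewrite ger0_norm; last by nra.
  suff : (1 - f) * u <= (1 - f) * (2 * mdist x (c t)).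
    have -> : (1 - f) * (2 * mdist x (c t)) =
      2 * (mdist x (c t) - f * mdist x (c t)) by ring.
    by rewrite fD; lra.
  by rewrite ler_wpM2l //; lra.
have wc : mdist (k (f * u)) (c (t - m)) <= r + e.
  have := metric_triangle (k (f * u)) (k' (mdist x (c t) - m)) (c (t - m)).
  rewrite (metric_sym (k (f * u)) (k' _)).
  have : f * r <= 1 * r by rewrite ler_wpM2r //; lra.
  by lra.
have := cat0_quadrilateral hX (c (t - m)) (c t) (k u) (k (f * u)).
rewrite hc -/r (metric_sym (c (t - m)) (k u)).
have -> : t - m - t = - m by ring.
rewrite normrN (gtr0_norm m0).
have A0 := mdist_ge0 (k u) (k (f * u)).
have B0 := mdist_ge0 (k (f * u)) (c (t - m)).
have := near_u _ fu; rewrite -/r => rr.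
have : mdist (k u) (k (f * u)) ^+ 2 <= (2 * m) ^+ 2.
  by rewrite ler_pXn2r ?nnegrE //; lra.
have : mdist (k (f * u)) (c (t - m)) ^+ 2 <= (r + e) ^+ 2.
  by rewrite ler_pXn2r ?nnegrE //; lra.
have : r ^+ 2 <= mdist (c t) (k (f * u)) ^+ 2.
  by rewrite ler_pXn2r ?nnegrE //; lra.
lra.
Qed.

End OneAxis.

(** If a geodesic between points with feet far apart avoided the axis in between, then
  its point nearest to the middle would be far from the axis, at nearly constant
  distance from all points of a long interval.  With slope 0, this is excluded by
  the absence of flat half planes. *)
Lemma fellow_travel c : rank_one_line c -> exists M C, [/\ 0 <= M, 0 <= C &
  forall x y s s' t (k : R -> X), foot c x s -> foot c y s' -> s + M <= t -> t + M <= s' ->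
  geodesic_segment k x y ->
  exists2 u, 0 <= u <= mdist x y & mdist (c t) (k u) <= C].
Proof.
move=> rk; have [hc _ _] := rk.
have [m [e [m0 e0 H]]] := no_flat_sector_uniform hX pX rk (ltr01 : 0 < 1).
have e20 : 0 < e / 2 by lra.
have [M1 M10 back] := nearest_point_backward rk m0 e20.
have [M2 M20 forth] := nearest_point_backward (rank_one_line_rev rk) m0 e20.
(* At this distance e absorbs the error 5 m^2 of nearest_point_backward. *)
pose C := m + 5 * m ^+ 2 / e.
have q0 : 0 <= 5 * m ^+ 2 / e.
  by apply: divr_ge0 (ltW e0); have := sqr_ge0 m; lra.
have C0 : 0 <= C by rewrite /C; lra.
exists (M1 + M2), C; split => //; first by lra.
move=> x y s s' t k fx fy st ts gk.
have [_ _ gkl] := gk.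
have [u hu near_u] := @nearest_point_on_arc R X (c t) k 0 (mdist x y)
  (mdist_ge0 _ _) (fun a b ha hb => ltac:(by rewrite gkl)).
exists u => //; rewrite leNgt; apply/negP => far.
set r := mdist (c t) (k u) in far *.
have re : 5 * m ^+ 2 <= r * e.
  by rewrite -ler_pdivrMr //; move: far; rewrite /C; lra.
have sq A : A ^+ 2 <= (r + e / 2) ^+ 2 + 5 * m ^+ 2 -> A <= r + e.
  move=> hA; have [A0|A0] := leP A 0; first by lra.
  rewrite -(@ler_pXn2r _ 2%N) ?nnegrE //; [|lra|lra].
  by apply: (le_trans hA); nra.
have h1 : mdist (k u) (c (t - m)) <= r + e.
  by apply: sq; apply: (back x y s t k u) => //; lra.
have h2 : mdist (k u) (c (t + m)) <= r + e.
  have hu' : 0 <= mdist x y - u <= mdist y x by rewrite (metric_sym y); lra.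
  have := forth y x (- s') (- t) _ (mdist x y - u) (foot_opp fy) ltac:(lra)
    (geodesic_segment_rev gk) hu'.
  rewrite subKr !opprK -/r opprB opprK (addrC m) => h; apply: sq; apply: h.
  by move=> v hv; apply: near_u; rewrite (metric_sym y) in hv; lra.
have conv := mdist_line_convex hX rk (k u).
have Dt : mdist (k u) (c t) = r by rewrite metric_sym.
have [] := H t (k u) 0.
- by rewrite normr0 subrr.
- by rewrite Dt; move: far; rewrite /C; lra.
move=> tau htau; rewrite mul0r subr0 Dt => /lt_geF; rewrite ler_norml.
have upper v : 0 <= v -> v <= m ->
    mdist (k u) (c (t + v)) <= r + e /\ mdist (k u) (c (t - v)) <= r + e.
  move=> v0 vm.
  have := conv t (t + v) (t + m) ltac:(lra) ltac:(lra).
  have := conv (t - m) (t - v) t ltac:(lra) ltac:(lra).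
  rewrite Dt; move: (mdist _ _) (mdist _ (c (t + v))) => A B hA hB.
  by split; rewrite -(ler_pM2l m0); nra.
have lower v : `|v| * (2 * r) <= `|v| *
    (mdist (k u) (c (t + v)) + mdist (k u) (c (t - v))).
  have [v0|/ltW v0] := leP 0 v.
    have := conv (t - v) t (t + v) ltac:(lra) ltac:(lra).
    by rewrite Dt ger0_norm //; lra.
  have := conv (t + v) t (t - v) ltac:(lra) ltac:(lra).
  by rewrite Dt ler0_norm //; lra.
move=> /negP; apply.
have [tau0|tau0] := eqVneq tau 0; first by rewrite tau0 addr0 Dt; lra.
have tau_gt0 : 0 < `|tau| by rewrite normr_gt0.
have := lower tau; rewrite ler_pM2l //.
have := upper `|tau| (normr_ge0 _) htau.
have [tp|/ltW tp] := leP 0 tau.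
  by rewrite ger0_norm // => -[? ?] ?; lra.
by rewrite ler0_norm // opprK => -[? ?] ?; lra.
Qed.

End FellowTravel.

Section Ends.
Context {R : realType} (X : metricType R).
Hypothesis (hX : Hadamard_space X) (pX : proper_space X).

Lemma foot_unique (c : R -> X) x s s' : geodesic_line c ->
  foot c x s -> foot c x s' -> s = s'.
Proof.
move=> hc; wlog ss : s s' / s <= s' => [W fs fs'|fs fs'].
  by have [|/ltW] := leP s s' => h; [exact: W|apply/esym; exact: W].
have hf : 0 <= (2^-1 : R) <= 1 by lra.
have := cat0_stewart hX x (geodesic_line_segment hc ss) hf.
have e : mdist x (c s) = mdist x (c s').
  by apply/eqP; rewrite eq_le fs fs'.
rewrite -!(metric_sym x) -e hc distrC ger0_norm ?subr_ge0 //.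
have : mdist x (c s) ^+ 2 <= mdist x (c (s + 2^-1 * (s' - s))) ^+ 2.
  by rewrite ler_pXn2r ?nnegrE ?mdist_ge0.
move: (mdist x _) (mdist x (c (_ + _))) => A B h1 h2.
have /eqP : (s' - s) ^+ 2 = 0.
  by apply/eqP; rewrite eq_le sqr_ge0 andbT; lra.
by rewrite sqrf_eq0 subr_eq0 => /eqP.
Qed.

Lemma asymptotic_boundary_point (c c' : R -> X) :
  asymptotic c c' -> boundary_point c = boundary_point c'.
Proof.
move=> [K hK]; apply/seteqP; split=> k [rk [L hL]]; split=> //; exists (K + L) => t t0.
  apply: le_trans (metric_triangle _ (c t) _) _; rewrite (metric_sym (c' t)).
  by rewrite lerD ?hK ?hL.
by apply: le_trans (metric_triangle _ (c' t) _) _; rewrite lerD ?hK ?hL.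
Qed.

(** A geodesic to a point whose feet are far ahead on both axes would follow both
  of them for a long time, and the axes would be asymptotic. *)
Lemma distinct_ends_separated (c c' : R -> X) : rank_one_line c -> rank_one_line c' ->
    boundary_point c <> boundary_point c' ->
  exists T, forall x s s', foot c x s -> foot c' x s' -> T <= s -> T <= s' ->
  False.
Proof.
move=> rk rk' ends; apply: contrapT => /forallNP H; apply: ends.
have [hc _ _] := rk; have [hc' _ _] := rk'.
have {}H T : exists x s s', [/\ foot c x s, foot c' x s', T <= s & T <= s'].
  apply: contrapT => N; apply: (H T) => x s s' h1 h2 h3 h4.
  by apply: N; exists x, s, s'.
have [M [C [M0 C0 ft]]] := fellow_travel hX pX rk.
have [M' [C' [M'0 C'0 ft']]] := fellow_travel hX pX rk'.
apply: asymptotic_boundary_point.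
have f0 : foot c (c 0) 0 by move=> t; rewrite mdistxx mdist_ge0.
have [s0 f0'] := foot_exists (c 0) hc'.
pose t0 := M + M' + `|s0|.
have s00 := normr_ge0 s0; have s01 := ler_norm s0.
have D0 := mdist_ge0 (c 0) (c' 0).
exists (2 * C + 2 * C' + mdist (c 0) (c' 0) + 2 * t0) => t tge0.
have [tt|/ltW tt] := leP t t0.
  have := metric_triangle (c t) (c 0) (c' t).
  have := metric_triangle (c 0) (c' 0) (c' t).
  by rewrite hc hc' subr0 sub0r normrN !ger0_norm //; lra.
have [x [s [s' [fx fx' sT s'T]]]] := H (t + M + M').
have [k gk] := geodesic_segment_exists hX (c 0) x.
have [u hu cu] := ft _ _ _ _ t k f0 fx ltac:(rewrite /t0 in tt; lra) ltac:(lra) gk.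
have [u' hu' cu'] := ft' _ _ _ _ t k f0' fx' ltac:(rewrite /t0 in tt; lra) ltac:(lra) gk.
have e1 := mdist_geodesic_start gk hu; have e2 := mdist_geodesic_start gk hu'.
have l1 := mdist_lipschitz (c t) (k u) (c 0).
have l2 := mdist_lipschitz (c' t) (k u') (c 0).
have l3 := mdist_lipschitz (c 0) (c' 0) (c' t).
rewrite (metric_sym (k u)) e1 hc subr0 (ger0_norm tge0) in l1.
rewrite (metric_sym (k u')) e2 in l2.
rewrite hc' sub0r normrN (ger0_norm tge0) (metric_sym (c 0) (c' t)) in l3.
have kk : mdist (k u) (k u') <= C + C' + mdist (c 0) (c' 0).
  have [_ _ ->] := gk => //.
  by move: l1 l2 l3; rewrite !ler_norml; lra.
have := metric_triangle (c t) (k u) (c' t).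
have := metric_triangle (k u) (k u') (c' t).
rewrite (metric_sym (k u') (c' t)).
have : 0 <= t0 by rewrite /t0; lra.
lra.
Qed.

End Ends.

(** * Ping-pong with two rank one isometries *)

(** The indices of the four isometries g, g^-1, h, h^-1: the second component
  distinguishes an isometry from its inverse. *)
Definition letter : Type := (bool * bool)%type.

Definition letter_inv (a : letter) : letter := (a.1, ~~ a.2).

Lemma letter_invK : involutive letter_inv.
Proof. by move=> [i e]; rewrite /letter_inv /= negbK. Qed.

Section PingPong.
Context {R : realType} (X : metricType R).
Hypothesis (hX : Hadamard_space X) (pX : proper_space X).
Variables (act : letter -> X -> X) (axis : letter -> R -> X) (o : X).
Hypothesis act_isometry :
  forall a x y, mdist (act a x) (act a y) = mdist x y.
Hypothesis act_axis : forall a, exists2 l, 0 < l &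
  forall t, act a (axis a t) = axis a (t + l).
Hypothesis axis_rank_one : forall a, rank_one_line (axis a).
Hypothesis axis_inv : forall a t, axis (letter_inv a) t = axis a (- t).
Hypothesis axis_ends : forall a b, a.1 != b.1 ->
  boundary_point (axis a) <> boundary_point (axis b).

(** The attracting set U a consists of the points whose foot on the axis of the letter
  a is far ahead.  These sets are disjoint because the ends of the axes differ, the
  letter a moves feet forward along its axis, and geodesics between points whose
  feet are far apart pass near the axis at a bounded distance from o. *)
Lemma ping_pong : exists (U : letter -> set X) (N0 : nat) (C : R), [/\
  forall a b x, U a x -> U b x -> a = b,
  forall N a x, (N0 <= N)%N -> ~ U (letter_inv a) x ->
    U a (iter N (act a) x) &
  forall N a x z k, (N0 <= N)%N -> ~ U (letter_inv a) x -> ~ U a z ->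
    geodesic_segment k z (iter N (act a) x) ->
    exists2 u, 0 <= u <= mdist z (iter N (act a) x) & mdist o (k u) <= C].
Proof.
have geo a : geodesic_line (axis a) by have [] := axis_rank_one a.
have inv_axis a : axis (letter_inv a) = fun t => axis a (- t).
  by apply/funext => t; exact: axis_inv.
have /choice[T0 hT0] : forall ab : letter * letter, exists T,
    ab.1.1 != ab.2.1 -> forall x s s',
    foot (axis ab.1) x s -> foot (axis ab.2) x s' -> T <= s -> T <= s' -> False.
  move=> [a b] /=; have [ab|ab] := boolP (a.1 != b.1); last by exists 0.
  have [T hT] := distinct_ends_separated hX pX (axis_rank_one a)
    (axis_rank_one b) (axis_ends ab).
  by exists T => _.
have /choice[MC hMC] : forall a, exists MC : R * R, [/\ 0 <= MC.1, 0 <= MC.2 &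
  forall x y s s' t (k : R -> X), foot (axis a) x s -> foot (axis a) y s' ->
    s + MC.1 <= t -> t + MC.1 <= s' -> geodesic_segment k x y ->
  exists2 u, 0 <= u <= mdist x y & mdist (axis a t) (k u) <= MC.2].
  move=> a; have [M [C h]] := fellow_travel hX pX (axis_rank_one a).
  by exists (M, C).
have /choice[l hl] : forall a, exists l, 0 < l /\
    forall t, act a (axis a t) = axis a (t + l).
  by move=> a; have [l l0 h] := act_axis a; exists l.
pose T := 1 + \sum_ab `|T0 ab|.
have sum_ge (I : finType) (F : I -> R) i : `|F i| <= \sum_j `|F j|.
  by rewrite (bigD1 i) //= lerDl sumr_ge0.
have T_gt0 : 0 < T by rewrite ltr_wpDr // sumr_ge0.
have TT0 ab : T0 ab <= T.
  apply: (le_trans (ler_norm _)); apply: (le_trans (sum_ge _ T0 ab)).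
  by rewrite lerDr.
pose U a := [set x | exists2 s, foot (axis a) x s & T <= s].
pose Na a := Num.bound ((2 * T + 2 * (MC a).1) / l a).
(* Sums over the four letters serve as common upper bounds. *)
pose N0 := (\sum_a Na a)%N.
pose C := \sum_a `|(MC a).2 + mdist o (axis a (T + (MC a).1))|.
have iter_foot N a x s : foot (axis a) x s ->
    foot (axis a) (iter N (act a) x) (s + N%:R * l a).
  move=> fs; elim: N => [|N IH] /=; first by rewrite mul0r addr0.
  have [_ ha] := hl a.
  have := foot_isometry (act_isometry a) ha IH.
  by rewrite -natr1; congr foot; ring.
have Nl N a : (N0 <= N)%N -> 2 * T + 2 * (MC a).1 <= N%:R * l a.
  move=> NN; have [l0 _] := hl a; have [M0 _ _] := hMC a.
  rewrite -ler_pdivrMr //; apply: ltW; apply: lt_le_trans (archi_boundP _) _.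
    by apply: divr_ge0 (ltW l0); lra.
  rewrite ler_nat; apply: leq_trans NN.
  by rewrite /N0 (bigD1 a) //= leq_addr.
have notU a x : ~ U (letter_inv a) x -> exists2 s, foot (axis a) x s & - T < s.
  move=> h; have [s fs] := foot_exists x (geo a); exists s => //.
  rewrite ltNge; apply/negP => sT; apply: h; exists (- s); last by lra.
  by rewrite inv_axis; exact: foot_opp.
exists U, N0, C; split.
- move=> a b x [s fs Ts] [s' fs' Ts'].
  have [ab|ab] := boolP (a.1 != b.1).
    by have := hT0 (a, b) ab x s s' fs fs'; case; exact: le_trans (TT0 _) _.
  have [//|bN] := eqVneq a b.
  have bE : b = letter_inv a.
    by move: ab bN; case: (a) (b) => [[] []] [[] []].
  move: fs'; rewrite bE inv_axis => /foot_opp; under eq_fun do rewrite opprK.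
  by move=> /(foot_unique hX (geo a) fs) ss; exfalso; lra.
- move=> N a x NN /notU[s fs sT]; exists (s + N%:R * l a); first exact: iter_foot.
  by have := Nl N a NN; have [M0 _ _] := hMC a; lra.
- move=> N a x z k NN /notU[s fs sT] nz gk.
  have [M0 C0 h] := hMC a.
  have [s' fz] := foot_exists z (geo a).
  have s'T : s' < T by rewrite ltNge; apply/negP => Ts; apply: nz; exists s'.
  have NlN := Nl N a NN.
  have [u hu hC] := h z _ s' _ (T + (MC a).1) k fz (iter_foot N _ _ _ fs)
    ltac:(lra) ltac:(lra) gk.
  exists u => //; apply: le_trans (metric_triangle _ (axis a (T + (MC a).1)) _) _.
  have := sum_ge _ (fun a => (MC a).2 + mdist o (axis a (T + (MC a).1))) a.
  rewrite -/C => /(le_trans (ler_norm _)); lra.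
Qed.

End PingPong.

(** Each condition excludes one of the four letters at most. *)
Lemma letter_avoiding (P1 P2 P3 : letter -> Prop) :
    (forall a b, P1 a -> P1 b -> a = b) -> (forall a b, P2 a -> P2 b -> a = b) ->
    (forall a b, P3 a -> P3 b -> a = b) ->
  exists a, [/\ ~ P1 a, ~ P2 a & ~ P3 a].
Proof.
move=> h1 h2 h3; apply: contrapT => H.
pose S (P : letter -> Prop) := [set a | `[< P a >]]%SET.
have card1 P : (forall a b, P a -> P b -> a = b) -> (#|S P| <= 1)%N.
  move=> hP; apply/card_le1_eqP => a b; rewrite !inE => Pa Pb.
  exact: hP.
have : [set: letter]%SET = (S P1 :|: S P2 :|: S P3)%SET.
  apply/setP => a; rewrite !inE -!asbool_or; apply/esym/asboolP.
  apply: contrapT => h; apply: H; exists a.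
  by split=> h'; apply: h; [left; left|left; right|right].
move=> /(congr1 (fun A : {set letter} => #|A|)); rewrite cardsT card_prod card_bool.
have c12 := leq_of_leqif (leq_card_setU (S P1) (S P2)).
have c123 := leq_of_leqif (leq_card_setU (S P1 :|: S P2)%SET (S P3)).
move=> e; suff : (2 * 2 <= 1 + 1 + 1)%N by [].
rewrite e; apply: leq_trans c123 (leq_add _ (card1 _ h3)).
exact: leq_trans c12 (leq_add (card1 _ h1) (card1 _ h2)).
Qed.

(** * Almost additive products in the group *)

Lemma independent_ping_pong {R : realType} (X : metricType R)
    (hX : Hadamard_space X) (pX : proper_space X) (act : letter -> X -> X) (o : X) :
    (forall a, is_isometry (act a)) ->
    (forall a, cancel (act a) (act (letter_inv a))) ->
    independent_rank_one (act (true, true)) (act (false, true)) ->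
  exists (U : letter -> set X) (N0 : nat) (C : R), [/\
  forall a b x, U a x -> U b x -> a = b,
  forall N a x, (N0 <= N)%N -> ~ U (letter_inv a) x ->
    U a (iter N (act a) x) &
  forall N a x z k, (N0 <= N)%N -> ~ U (letter_inv a) x -> ~ U a z ->
    geodesic_segment k z (iter N (act a) x) ->
    exists2 u, 0 <= u <= mdist z (iter N (act a) x) & mdist o (k u) <= C].
Proof.
move=> iso can [[_ [c ax]] [_ [c' ax']] disj].
pose line i := if i then c else c'.
have axl i : rank_one_axis (act (i, true)) (line i) by case: i.
pose axis (a : letter) t := line a.1 (if a.2 then t else - t).
have rk1 i : rank_one_line (line i).
  have [g [l l0 hl] flat] := axl i; split=> //; exists (act (i, true)) => //.
  by exists l.
apply: (@ping_pong R X hX pX act axis o).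
- by move=> a; have [] := iso a.
- move=> [i e]; have [_ [l l0 hl] _] := axl i; exists l => // t.
  case: e; rewrite /axis /=; first exact: hl.
  rewrite -[RHS](can (i, true)) hl.
  by have -> : - (t + l) + l = - t by ring.
- by move=> [i []]; [exact: rk1|exact: rank_one_line_rev].
- by move=> [i e] t; rewrite /axis /=; case: e => //=; rewrite opprK.
- move=> a b ab e.
  have mem (d : letter) : boundary_endpoints (act (d.1, true)) (boundary_point (axis d)).
    by exists (line d.1) => //; case: d => i []; [left|right].
  suff : (boundary_endpoints (act (true, true))
    `&` boundary_endpoints (act (false, true))) (boundary_point (axis a)).
    by rewrite disj.
  have := mem a; have := mem b; rewrite -e.
  by move: ab; case: (a) (b) => [[] ?] [[] ?].
Qed.

Section ProductDisplacement.
Context {R : realType} (X : metricType R).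
Hypothesis hX : Hadamard_space X.
Variables (o : X) (C : R).
Implicit Types g f h : X -> X.

Let isom g := forall x y, mdist (g x) (g y) = mdist x y.

(** With z = g w, this says that the decomposition of the displacement of o into g and
  then w is almost free of backtracking. *)
Definition follows g (z : X) : Prop := forall k, geodesic_segment k o z ->
  exists2 u, 0 <= u <= mdist o z & mdist (g o) (k u) <= C.

Lemma follows_translate g k z : isom g -> cancel g k -> cancel k g ->
    (forall c, geodesic_segment c (k o) z ->
      exists2 u, 0 <= u <= mdist (k o) z & mdist o (c u) <= C) ->
  follows g (g z).
Proof.
move=> ig gk kg pass c [c0 c1 cl].
have e : mdist (k o) z = mdist o (g z) by rewrite -ig kg.
have gkc : geodesic_segment (k \o c) (k o) z.
  split; rewrite ?e /=; [by rewrite c0|by rewrite c1 gk|].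
  by move=> s t hs ht; rewrite -ig !kg cl.
have [u hu uC] := pass _ gkc; exists u; first by rewrite -e.
by apply: le_trans uC; rewrite -[leRHS]ig /= kg.
Qed.

Lemma follows_additive g f h : isom g -> isom f -> isom h ->
    follows g (g (f (h o))) ->
  `|mdist o (g (f (h o))) - mdist o (g o) - mdist o (h o)|
    <= 2 * C + mdist o (f o).
Proof.
move=> ig jf ih fol.
have [k gk] := geodesic_segment_exists hX o (g (f (h o))).
have [u hu uC] := fol k gk.
have d1 := mdist_geodesic_start gk hu.
have d2 := mdist_geodesic_end gk hu.
have t1 := metric_triangle o (k u) (g o); rewrite (metric_sym (k u)) in t1.
have t2 := metric_triangle (g o) (k u) (g (f (h o))).
have t3 := metric_triangle (f o) o (f (h o)).
have t4 := metric_triangle o (f o) (f (h o)).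
have t5 := metric_triangle o (g o) (g (f (h o))).
rewrite !ig in t2 t5; rewrite !jf (metric_sym (f o)) in t3; rewrite jf in t4.
have C0 : 0 <= C by apply: le_trans uC; exact: mdist_ge0.
by rewrite ler_norml; apply/andP; split; lra.
Qed.

(** If the last factors have nearly the same length, then the images of o under both
  first factors lie near the same point of one geodesic. *)
Lemma follows_close g f h g' h' : isom g -> isom f -> isom h ->
    isom g' -> isom h' -> g (f (h o)) = g' (f (h' o)) ->
    follows g (g (f (h o))) -> follows g' (g' (f (h' o))) ->
    `|mdist o (h o) - mdist o (h' o)| <= 1 ->
  mdist (g o) (g' o) <= 4 * C + 2 * mdist o (f o) + 1.
Proof.
move=> ig jf ih ig' ih' e fol fol' l0; rewrite -e in fol'.
have [k gk] := geodesic_segment_exists hX o (g (f (h o))).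
have [u hu uC] := fol k gk; have [u' hu' uC'] := fol' k gk.
have d2 := mdist_geodesic_end gk hu; have d2' := mdist_geodesic_end gk hu'.
have l1 := mdist_lipschitz (g o) (k u) (g (f (h o))).
have l1' := mdist_lipschitz (g' o) (k u') (g (f (h o))).
have l2 := mdist_lipschitz o (f o) (f (h o)).
have l2' := mdist_lipschitz o (f o) (f (h' o)).
rewrite d2 ig in l1; rewrite d2' {1}e ig' in l1'; rewrite !jf in l2 l2'.
have uu : mdist (k u) (k u') = `|u - u'| by have [_ _ ->] := gk.
move: l0 l1 l1' l2 l2'; rewrite !ler_norml.
have := metric_triangle (g o) (k u) (g' o).
have := metric_triangle (k u) (k u') (g' o); rewrite (metric_sym (k u') (g' o)).
rewrite uu; have [p|/ltW p] := leP 0 (u - u'); rewrite ?(ger0_norm p) ?(ler0_norm p).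
  by move=> ? ? /andP[? ?] /andP[? ?] /andP[? ?] /andP[? ?] /andP[? ?]; lra.
by move=> ? ? /andP[? ?] /andP[? ?] /andP[? ?] /andP[? ?] /andP[? ?]; lra.
Qed.

End ProductDisplacement.

Section GenericProduct.
Context {R : realType} (X1 X2 : metricType R).
Hypothesis (hX1 : Hadamard_space X1) (pX1 : proper_space X1).
Hypothesis (hX2 : Hadamard_space X2) (pX2 : proper_space X2).
Variables (o : X1 * X2) (G : set ((X1 -> X1) * (X2 -> X2))).
Hypothesis hG : isometry_group G.

Local Notation elt := ((X1 -> X1) * (X2 -> X2))%type.

Definition pair_comp (g h : elt) : elt := (g.1 \o h.1, g.2 \o h.2).

Definition displ1 (g : elt) : R := mdist o.1 (g.1 o.1).
Definition displ2 (g : elt) : R := mdist o.2 (g.2 o.2).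

Lemma group_comp g h : G g -> G h -> G (pair_comp g h).
Proof. by have [_ _ h' _] := hG; exact: h'. Qed.

Lemma group_isometry1 g : G g -> forall x y, mdist (g.1 x) (g.1 y) = mdist x y.
Proof. by have [h _ _ _] := hG; move=> /h[[]]. Qed.

Lemma group_isometry2 g : G g -> forall x y, mdist (g.2 x) (g.2 y) = mdist x y.
Proof. by have [h _ _ _] := hG; move=> /h[_ []]. Qed.

Lemma group_inverse g : G g -> exists h, [/\ G h, cancel g.1 h.1, cancel h.1 g.1,
  cancel g.2 h.2 & cancel h.2 g.2].
Proof.
have [iso _ _ inv] := hG; move=> Gg; have [h [Gh c1 c2]] := inv g Gg.
have [[b1 _] [b2 _]] := iso _ Gg.
by exists h; split => //; [exact/(bij_can_sym b1)|exact/(bij_can_sym b2)].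
Qed.

Definition pair_iter n (g : elt) : elt := (iter n g.1, iter n g.2).

Lemma group_iter n g : G g -> G (pair_iter n g).
Proof.
move=> Gg; elim: n => [|n IH]; first by have [_ h _ _] := hG; exact: h.
exact: (group_comp Gg IH).
Qed.

Hypothesis hrank : exists g h : elt,
  [/\ G g, G h, independent_rank_one g.1 h.1 & independent_rank_one g.2 h.2].

(** Ping-pong in both factors at once, with f = b^N a^N.  Each factor excludes at most
  one letter as a and one as b, and b has to differ from the inverse of a; so at
  most three of the four letters are excluded at each choice. *)
Lemma generic_product : exists (F : seq elt) (C : R),
  (forall f, f \in F -> G f) /\
  forall g h, G g -> G h -> exists2 f, f \in F &
    follows o.1 C g.1 (g.1 (f.1 (h.1 o.1))) /\
    follows o.2 C g.2 (g.2 (f.2 (h.2 o.2))).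
Proof.
have [g0 [h0 [Gg0 Gh0 ind1 ind2]]] := hrank.
have [gi [Ggi g1 g1' g2 g2']] := group_inverse Gg0.
have [hi [Ghi h1 h1' h2 h2']] := group_inverse Gh0.
pose act (a : letter) : elt :=
  if a.1 then (if a.2 then g0 else gi) else (if a.2 then h0 else hi).
have Gact a : G (act a) by case: a => [[] []].
have [iso _ _ _] := hG.
have [U1 [N1 [C1 [uniq1 attr1 pass1]]]] := @independent_ping_pong R X1 hX1 pX1
  (fun a => (act a).1) o.1 (fun a => proj1 (iso _ (Gact a)))
  (fun a => ltac:(by case: a => [[] []])) ind1.
have [U2 [N2 [C2 [uniq2 attr2 pass2]]]] := @independent_ping_pong R X2 hX2 pX2
  (fun a => (act a).2) o.2 (fun a => proj2 (iso _ (Gact a)))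
  (fun a => ltac:(by case: a => [[] []])) ind2.
pose N := (N1 + N2)%N.
have NN1 : (N1 <= N)%N by exact: leq_addr.
have NN2 : (N2 <= N)%N by exact: leq_addl.
pose f (ab : letter * letter) :=
  pair_comp (pair_iter N (act ab.2)) (pair_iter N (act ab.1)).
have Gf ab : G (f ab) by apply: group_comp; apply: group_iter.
exists [seq f ab | ab <- enum {: letter * letter}], (Num.max C1 C2); split.
  by move=> _ /mapP[ab _ ->].
move=> g h Gg Gh; have [k [Gk k1 k1' k2 k2']] := group_inverse Gg.
have inj_inv (P : letter -> Prop) : (forall a b, P a -> P b -> a = b) ->
    forall a b, P (letter_inv a) -> P (letter_inv b) -> a = b.
  by move=> hP a b Pa Pb; rewrite -(letter_invK a) (hP _ _ Pa Pb) letter_invK.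
have [a [a1 a2 _]] := @letter_avoiding (fun a => U1 (letter_inv a) (h.1 o.1))
  (fun a => U2 (letter_inv a) (h.2 o.2)) (fun=> False)
  (inj_inv (U1 ^~ _) (fun a b => uniq1 a b _))
  (inj_inv (U2 ^~ _) (fun a b => uniq2 a b _)) (fun a b => False_ind _).
have [b [b1 b2 ba]] := @letter_avoiding (fun b => U1 b (k.1 o.1))
  (fun b => U2 b (k.2 o.2)) (fun b => b = letter_inv a)
  (fun a b => uniq1 a b _) (fun a b => uniq2 a b _)
  (fun b b' e e' => etrans e (esym e')).
have ba' : letter_inv b <> a by move=> e; apply: ba; rewrite -e letter_invK.
exists (f (a, b)); first by apply: map_f; rewrite mem_enum.
split.
- apply: (follows_translate (group_isometry1 Gg) k1 k1') => c gc.
  have [u hu uC] := pass1 N b _ _ _ NN1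
    (fun H => ba' (uniq1 _ _ _ H (attr1 N a _ NN1 a1))) b1 gc.
  by exists u => //; rewrite le_max uC.
- apply: (follows_translate (group_isometry2 Gg) k2 k2') => c gc.
  have [u hu uC] := pass2 N b _ _ _ NN2
    (fun H => ba' (uniq2 _ _ _ H (attr2 N a _ NN2 a2))) b2 gc.
  by exists u => //; rewrite le_max uC orbT.
Qed.

(** Here phi chooses the connecting element.  The last clause is what bounds the
  number of pairs with the same product. *)
Lemma almost_additive_product : exists (F : seq elt) (K : R) (phi : elt -> elt -> elt),
  [/\ 0 <= K, forall f, f \in F -> G f,
      forall g h, G g -> G h -> [/\ phi g h \in F,
        `|displ1 (pair_comp g (pair_comp (phi g h) h)) - displ1 g - displ1 h| <= K &
        `|displ2 (pair_comp g (pair_comp (phi g h) h)) - displ2 g - displ2 h| <= K] &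
      forall g h g' h', G g -> G h -> G g' -> G h' -> phi g h = phi g' h' ->
        pair_comp g (pair_comp (phi g h) h) = pair_comp g' (pair_comp (phi g' h') h') ->
        `|displ1 h - displ1 h'| <= 1 -> `|displ2 h - displ2 h'| <= 1 ->
        mdist (g.1 o.1) (g'.1 o.1) <= K /\ mdist (g.2 o.2) (g'.2 o.2) <= K].
Proof.
have [F [C [GF HF]]] := generic_product.
have /choice[phi hphi] : forall gh : elt * elt, exists f,
    G gh.1 -> G gh.2 -> [/\ f \in F,
    follows o.1 C gh.1.1 (gh.1.1 (f.1 (gh.2.1 o.1))) &
    follows o.2 C gh.1.2 (gh.1.2 (f.2 (gh.2.2 o.2)))].
  move=> [g h] /=; have [[Gg Gh]|N] := pselect (G g /\ G h); last first.
    by exists (idfun, idfun) => Gg Gh; case: N.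
  by have [f fF [f1 f2]] := HF g h Gg Gh; exists f.
pose S := \sum_(f <- F) (displ1 f + displ2 f).
have d1 f : 0 <= displ1 f by exact: mdist_ge0.
have d2 f : 0 <= displ2 f by exact: mdist_ge0.
have S0 : 0 <= S by apply: sumr_ge0 => f _; rewrite addr_ge0.
have FS f : f \in F -> displ1 f + displ2 f <= S.
  move=> fF; rewrite /S (big_rem f) //= lerDl; apply: sumr_ge0 => f' _.
  by rewrite addr_ge0.
have Cn := normr_ge0 C; have Cl := ler_norm C.
exists F, (4 * `|C| + 2 * S + 1), (fun g h => phi (g, h)); split=> //.
- by lra.
- move=> g h Gg Gh; have [fF f1 f2] := hphi (g, h) Gg Gh.
  have Gf := GF _ fF; have := FS _ fF; have := d1 (phi (g, h)); have := d2 (phi (g, h)).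
  move=> ? ? ?; split=> //.
    apply: le_trans (follows_additive hX1 (group_isometry1 Gg)
      (group_isometry1 Gf) (group_isometry1 Gh) f1) _.
    by rewrite -/(displ1 _); lra.
  apply: le_trans (follows_additive hX2 (group_isometry2 Gg)
    (group_isometry2 Gf) (group_isometry2 Gh) f2) _.
  by rewrite -/(displ2 _); lra.
- move=> g h g' h' Gg Gh Gg' Gh' ephi ecomp l1 l2.
  have [fF f1 f2] := hphi (g, h) Gg Gh; have [_ f1' f2'] := hphi (g', h') Gg' Gh'.
  rewrite -ephi /= in f1' f2'; rewrite -ephi in ecomp.
  have Gf := GF _ fF; have := FS _ fF; have := d1 (phi (g, h)); have := d2 (phi (g, h)).
  have e1 := congr1 (fun u : elt => u.1 o.1) ecomp.
  have e2 := congr1 (fun u : elt => u.2 o.2) ecomp.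
  move=> ? ? ?; split.
    apply: le_trans (follows_close hX1 (group_isometry1 Gg) (group_isometry1 Gf)
      (group_isometry1 Gh) (group_isometry1 Gg') (group_isometry1 Gh') e1 f1 f1' l1) _.
    by rewrite -/(displ1 _); lra.
  apply: le_trans (follows_close hX2 (group_isometry2 Gg) (group_isometry2 Gf)
    (group_isometry2 Gh) (group_isometry2 Gg') (group_isometry2 Gh') e2 f2 f2' l2) _.
  by rewrite -/(displ2 _); lra.
Qed.

End GenericProduct.

(** * Counting products *)

Section CountingProducts.
Context {R : realType} (X1 X2 : metricType R).
Hypothesis (hX1 : Hadamard_space X1) (pX1 : proper_space X1).
Hypothesis (hX2 : Hadamard_space X2) (pX2 : proper_space X2).
Local Notation elt := ((X1 -> X1) * (X2 -> X2))%type.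
Variables (o : X1 * X2) (G : set elt).
Hypothesis hG : isometry_group G.
Hypothesis pG : acts_properly G.
Hypothesis hrank : exists g h : elt,
  [/\ G g, G h, independent_rank_one g.1 h.1 & independent_rank_one g.2 h.2].

Local Notation displ1 := (displ1 o).
Local Notation displ2 := (displ2 o).

Definition near_displ (w : R * R) (e : R) (u : elt) : Prop :=
  `|displ1 u - w.1| <= e /\ `|displ2 u - w.2| <= e.

Lemma prod_dist_le (x y : X1 * X2) :
  prod_dist x y <= mdist x.1 y.1 + mdist x.2 y.2.
Proof.
rewrite /prod_dist -[leRHS]ger0_norm ?addr_ge0 ?mdist_ge0 // -sqrtr_sqr.
rewrite ler_wsqrtr // sqrrD addrAC lerDl mulrn_wge0 //.
by rewrite mulr_ge0 ?mdist_ge0.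
Qed.

Lemma finite_displ (K : R) : exists B : seq elt, forall g, G g ->
  displ1 g <= K -> displ2 g <= K -> g \in B.
Proof.
have K0 := normr_ge0 K; have KK := ler_norm K.
have r0 : 0 < 2 * `|K| + 1 by lra.
have /finite_seqP[B hB] := pG o r0.
exists B => g Gg g1 g2.
have : [set g | G g /\ prod_dist o (prod_act g o) <= 2 * `|K| + 1] g.
  split=> //; apply: le_trans (prod_dist_le _ _) _.
  by move: g1 g2; rewrite /displ1 /displ2 /=; lra.
by rewrite hB.
Qed.

(** A product determines its two factors up to the connecting element, the integral
  parts of the displacements of the second factor, and an element of a fixed ball.
  Hence products are almost as numerous as pairs. *)
Lemma product_count : exists (K : R) (N1 : nat), [/\ 0 <= K, (0 < N1)%N &
  forall (W S : seq elt) (n : nat), uniq W -> uniq S ->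
    (forall g, g \in W -> G g) ->
    (forall h, h \in S -> [/\ G h, displ1 h < n%:R & displ2 h < n%:R]) ->
  exists W' : seq elt, [/\ uniq W', forall u, u \in W' -> G u,
    (size W * size S <= N1 * n ^ 2 * size W')%N &
    forall u, u \in W' -> exists g h, [/\ g \in W, h \in S,
      `|displ1 u - displ1 g - displ1 h| <= K &
      `|displ2 u - displ2 g - displ2 h| <= K]]].
Proof.
have [F [K [phi [K0 GF add close]]]] :=
  almost_additive_product hX1 pX1 hX2 pX2 o hG hrank.
have [B hB] := finite_displ K.
exists K, (size F * size B).+1; split=> // W S n uW uS GW GS.
pose prod (p : elt * elt) := pair_comp p.1 (pair_comp (phi p.1 p.2) p.2).
pose PS := [seq (g, h) | g <- W, h <- S].
have uPS : uniq PS.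
  by apply: allpairs_uniq => // -[g h] [g' h'] _ _ /=.
have PSP p : p \in PS -> [/\ p.1 \in W, p.2 \in S, G p.1 & G p.2].
  case/allpairsP => -[g h] /= [gW hS ->]; split=> //; first exact: GW.
  by have [] := GS _ hS.
pose class (p : elt * elt) :=
  ((prod p, phi p.1 p.2), (Num.truncn (displ1 p.2), Num.truncn (displ2 p.2))).
have truncn_close x y : 0 <= x -> 0 <= y -> Num.truncn x = Num.truncn y ->
    `|x - y| <= 1 :> R.
  move=> x0 y0 e; have := truncn_itv x0; have := truncn_itv y0.
  rewrite e -natr1; move: (_%:R) => t ? ?; rewrite ler_norml; lra.
have classP p p' : p \in PS -> p' \in PS -> class p = class p' ->
    exists2 k, k \in B & p.1 = pair_comp p'.1 k.
  move=> /PSP[_ _ G1 G2] /PSP[_ _ G1' G2'] [e1 e2 e3 e4 e5].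
  have eprod : prod p = prod p' by rewrite /prod /pair_comp /= e1 e2.
  have [d1 d2] := close p.1 p.2 p'.1 p'.2 G1 G2 G1' G2' e3 eprod
    (truncn_close _ _ (mdist_ge0 _ _) (mdist_ge0 _ _) e4)
    (truncn_close _ _ (mdist_ge0 _ _) (mdist_ge0 _ _) e5).
  have [q [Gq q1 q1' q2 q2']] := group_inverse hG G1'.
  exists (pair_comp q p.1).
    apply: hB; first exact: group_comp.
      rewrite /displ1 /= -(group_isometry1 hG G1') q1' metric_sym; exact: d1.
    rewrite /displ2 /= -(group_isometry2 hG G1') q2' metric_sym; exact: d2.
  rewrite /pair_comp /=; case: (p.1) => a b /=; congr pair; apply/funext => x /=.
    by rewrite q1'.
  by rewrite q2'.
have /choice[rep hrep] : forall c, exists p', forall p, p \in PS -> class p = c ->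
    p' \in PS /\ class p' = c.
  move=> c; have [[p pPS pc]|N] := pselect (exists2 p, p \in PS & class p = c).
    by exists p.
  by exists ((idfun, idfun), (idfun, idfun)) => p pPS pc; case: N; exists p.
have /choice[kap hkap] : forall p, exists k, p \in PS ->
    k \in B /\ p.1 = pair_comp (rep (class p)).1 k.
  move=> p; have [pPS|] := boolP (p \in PS); last by exists (idfun, idfun).
  have [h1 h2] := hrep _ p pPS erefl.
  by have [k kB kE] := classP p _ pPS h1 (esym h2); exists k.
pose code p := (class p, kap p).
(* The class determines a representative pair; relative to it, kap locates the first
  factor, and then the product yields the second one. *)
have code_inj : {in PS &, injective code}.
  move=> p p' pP p'P [e1 e2 e3 e4 e5 e6].
  have ec : class p = class p' by rewrite /class /prod /pair_comp e1 e2 e3 e4 e5.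
  have eg : p.1 = p'.1.
    by rewrite (proj2 (hkap _ pP)) (proj2 (hkap _ p'P)) ec e6.
  have [_ _ G1 G2] := PSP _ pP; have [_ _ G1' G2'] := PSP _ p'P.
  have [fF _ _] := add _ _ G1' G2'; have Gf := GF _ fF.
  have [q [_ q1 _ q2 _]] := group_inverse hG G1'.
  have [r [_ r1 _ r2 _]] := group_inverse hG Gf.
  have ep : prod p = prod p' by rewrite /prod /pair_comp /= e1 e2.
  rewrite /prod e3 eg in ep.
  have ep1 x := congr1 (fun u : elt => r.1 (q.1 (u.1 x))) ep.
  have ep2 x := congr1 (fun u : elt => r.2 (q.2 (u.2 x))) ep.
  have eh : p.2 = p'.2.
    rewrite (surjective_pairing p.2) (surjective_pairing p'.2).
    congr pair; apply/funext => x.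
      by have := ep1 x; rewrite /= !q1 !r1.
    by have := ep2 x; rewrite /= !q2 !r2.
  by rewrite (surjective_pairing p) (surjective_pairing p') eg eh.
pose W' := undup [seq prod p | p <- PS].
have W'P u : u \in W' -> exists2 p, p \in PS & u = prod p.
  by rewrite mem_undup => /mapP[p pPS ->]; exists p.
exists W'; split.
- exact: undup_uniq.
- move=> u /W'P[p /PSP[_ _ G1 G2] ->]; have [fF _ _] := add _ _ G1 G2.
  by apply: group_comp => //; apply: group_comp => //; exact: GF.
- pose codes := [seq (c, k) | c <- [seq (uf, b) | uf <- [seq (u, f) | u <- W', f <- F],
      b <- [seq (b1, b2) | b1 <- iota 0 n, b2 <- iota 0 n]], k <- B].
  have -> : (size W * size S)%N = size (map code PS) by rewrite size_map size_allpairs.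
  apply: (@leq_trans (size codes)).
    apply: uniq_leq_size; first by rewrite map_inj_in_uniq.
    move=> _ /mapP[p pPS ->].
    have [_ hS G1 G2] := PSP _ pPS; have [_ lt1 lt2] := GS _ hS.
    have [fF _ _] := add _ _ G1 G2; have [kB _] := hkap _ pPS.
    have mem_trunc x : 0 <= x -> x < n%:R :> R -> Num.truncn x \in iota 0 n.
      move=> x0 xn; rewrite mem_iota /= add0n -(ltr_nat R).
      by apply: le_lt_trans xn; have /andP[] := truncn_itv x0.
    apply: allpairs_f => //; apply: allpairs_f; apply: allpairs_f => //.
    - by rewrite mem_undup map_f.
    - by apply: mem_trunc => //; exact: mdist_ge0.
    - by apply: mem_trunc => //; exact: mdist_ge0.
  rewrite !size_allpairs !size_iota.
  rewrite (_ : (_ * size B = size F * size B * n ^ 2 * size W')%N); last by lia.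
  by rewrite !leq_mul.
- move=> u /W'P[p pPS ->]; have [gW hS G1 G2] := PSP _ pPS.
  by exists p.1, p.2; have [_ a1 a2] := add _ _ G1 G2.
Qed.

(** Iterated products lose a factor N1 n^2 for each letter, which is negligible
  against the number of letters when that grows exponentially with n. *)
Lemma word_count : exists (K : R) (N1 : nat), [/\ 0 <= K, (0 < N1)%N &
  forall (S S' : seq elt) (n n' : nat) (v v' : R * R) (e e' : R),
    uniq S -> uniq S' ->
    (forall h, h \in S -> [/\ G h, displ1 h < n%:R, displ2 h < n%:R &
      near_displ v e h]) ->
    (forall h, h \in S' -> [/\ G h, displ1 h < n'%:R, displ2 h < n'%:R &
      near_displ v' e' h]) ->
  forall p q : nat, exists W : seq elt, [/\ uniq W, forall u, u \in W -> G u,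
    (size S ^ p * size S' ^ q <=
      (N1 * n ^ 2) ^ p * (N1 * n' ^ 2) ^ q * size W)%N &
    forall u, u \in W ->
      near_displ (p%:R * v.1 + q%:R * v'.1, p%:R * v.2 + q%:R * v'.2)
        (p%:R * (e + K) + q%:R * (e' + K)) u]].
Proof.
have [K [N1 [K0 N10 step]]] := product_count.
exists K, N1; split=> // S S' n n' v v' e e' uS uS' hS hS' p q.
have power W w d (T : seq elt) m t c : uniq W -> (forall u, u \in W -> G u) ->
    (forall u, u \in W -> near_displ w d u) -> uniq T ->
    (forall h, h \in T -> [/\ G h, displ1 h < m%:R, displ2 h < m%:R &
      near_displ t c h]) ->
  forall r : nat, exists W' : seq elt, [/\ uniq W', forall u, u \in W' -> G u,
    (size W * size T ^ r <= (N1 * m ^ 2) ^ r * size W')%N &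
    forall u, u \in W' -> near_displ (w.1 + r%:R * t.1, w.2 + r%:R * t.2)
      (d + r%:R * (c + K)) u].
  move=> uW GW dW uT hT; elim=> [|r [W' [uW' GW' sW' dW']]].
    exists W; split=> //; first by rewrite !expn0 muln1 mul1n.
    by move=> u uu; rewrite !mul0r !addr0; exact: dW.
  have hT' h : h \in T -> [/\ G h, displ1 h < m%:R & displ2 h < m%:R].
    by case/hT.
  have [W'' [uW'' GW'' sW'' dW'']] := step W' T m uW' uT GW' hT'.
  exists W''; split=> //.
    rewrite (expnS (size T)) (expnS (N1 * m ^ 2)) (mulnC (size T)) mulnA.
    apply: leq_trans (leq_mul sW' (leqnn _)) _.
    rewrite -mulnA; apply: leq_trans (leq_mul (leqnn _) sW'') _.
    by rewrite mulnCA mulnA.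
  move=> u /dW''[g [h [gW' hT0 a1 a2]]].
  have [b1 b2] := dW' g gW'; have [_ _ _ [c1 c2]] := hT h hT0.
  move: a1 a2 b1 b2 c1 c2; rewrite /near_displ /= -natr1 !ler_norml.
  move: (r%:R) => x.
  move=> /andP[? ?] /andP[? ?] /andP[? ?] /andP[? ?] /andP[? ?] /andP[? ?].
  by split; apply/andP; split; lra.
have Gid : G (idfun, idfun) by case: hG.
have [W [uW GW sW dW]] := power [:: (idfun, idfun)] (0, 0) 0 S n v e isT
  (fun u => ltac:(by rewrite inE => /eqP->))
  (fun u => ltac:(by rewrite inE => /eqP->;
     rewrite /near_displ /displ1 /displ2 /= !mdistxx subrr normr0)) uS hS p.
have [W' [uW' GW' sW' dW']] := power W _ _ S' n' v' e' uW GW dW uS' hS' q.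
exists W'; split=> //; last by move=> u /dW' /=; rewrite !add0r.
rewrite mul1n in sW; apply: leq_trans (leq_mul sW (leqnn _)) _.
by rewrite -!mulnA leq_mul2l sW' orbT.
Qed.

End CountingProducts.

(** * Growth rates *)

Section GrowthRate.
Context {R : realType} (X1 X2 : metricType R).
Local Notation elt := ((X1 -> X1) * (X2 -> X2))%type.
Variables (o : X1 * X2) (G : set elt).
Hypothesis pG : acts_properly G.

Local Notation displ1 := (displ1 o).
Local Notation displ2 := (displ2 o).

Definition annulus_size (eps theta : R) (n : nat) : nat :=
  #|` fset_set (slope_annulus G o eps theta n)|%fset.

Lemma finite_slope_annulus eps theta n : finite_set (slope_annulus G o eps theta n).
Proof.
have n0 : 0 < n.+1%:R :> R by rewrite ltr0n.
apply: sub_finite_set (pG o n0) => g [Gg _ /andP[_ gn] _]; split=> //.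
by rewrite -natr1; lra.
Qed.

Lemma counting_annulus eps theta n :
  counting (slope_annulus G o eps theta n) = (annulus_size eps theta n)%:R%:E :> \bar R.
Proof. by rewrite /counting asboolT //; exact: finite_slope_annulus. Qed.

Lemma subset_annulus_size (W : seq elt) eps theta n : uniq W ->
  (forall u, u \in W -> slope_annulus G o eps theta n u) ->
  (size W <= annulus_size eps theta n)%N.
Proof.
move=> uW hW; apply: uniq_leq_size => // u /hW h.
by rewrite in_fset_set; [exact: mem_set|exact: finite_slope_annulus].
Qed.

Lemma log_growth_le (N n : nat) (y : R) : (0 < n)%N ->
  (y%:E <= lne N%:R%:E / (n%:R : R)%:E)%E = (expR (y * n%:R) <= N%:R).
Proof.
move=> n0; have nR : 0 < n%:R :> R by rewrite ltr0n.
rewrite inver gt_eqF //.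
have [->|N0] := posnP N.
  rewrite /= lexx gt0_mulNye ?lte_fin ?invr_gt0 // leeNy_eq.
  by apply/esym/negbTE; rewrite -ltNge expR_gt0.
have NR : 0 < N%:R :> R by rewrite ltr0n.
rewrite lne_EFin // -EFinM lee_fin ler_pdivlMr //.
by rewrite -[in RHS](lnK (x := N%:R)) ?posrE // ler_expR.
Qed.

Lemma growth_eps_gt (a eps theta : R) : (a%:E < growth_eps G o eps theta)%E ->
  forall N, exists n, [/\ (N <= n)%N, (0 < n)%N &
    expR (a * n%:R) <= (annulus_size eps theta n)%:R].
Proof.
move=> ha N.
have : (a%:E < ereal_sup ((fun n => lne (counting (slope_annulus G o eps theta n)) / (n%:R : R)%:E)
   @` [set n | (N.+1 <= n)%N]))%E.
  apply: lt_le_trans ha _; apply: ereal_inf_lbound.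
  by exists [set n | (N.+1 <= n)%N] => //; exact: nbhs_infty_ge.
move=> /ereal_sup_gt[_ [n /= Nn <-]] /ltW.
have n0 : (0 < n)%N by exact: leq_trans Nn.
rewrite counting_annulus log_growth_le // => h; exists n; split=> //.
exact: ltnW.
Qed.

Lemma growth_eps_ge (y eps theta : R) :
  (forall N, exists n, [/\ (N <= n)%N, (0 < n)%N &
    expR (y * n%:R) <= (annulus_size eps theta n)%:R]) ->
  (y%:E <= growth_eps G o eps theta)%E.
Proof.
move=> H; apply: le_ereal_inf_tmp => _ [V [N _ NV] <-].
have [n [Nn n0 h]] := H N; apply: le_ereal_sup_tmp.
exists (lne (counting (slope_annulus G o eps theta n)) / (n%:R : R)%:E)%E.
  by exists n => //; exact: NV.
by rewrite counting_annulus log_growth_le.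
Qed.

Lemma growth_eps_le eps theta eps' theta' :
  `|theta - theta'| + eps <= eps' ->
  (growth_eps G o eps theta <= growth_eps G o eps' theta')%E.
Proof.
move=> h; apply: le_ereal_inf_tmp => _ [V VN <-].
apply: (@le_trans _ _ (ereal_sup ((fun n =>
    lne (counting (slope_annulus G o eps theta n)) / (n%:R : R)%:E)%E @` V))).
  by apply: ereal_inf_lbound; exists V.
apply: ge_ereal_sup => _ [n Vn <-]; apply: le_ereal_sup_tmp.
exists (lne (counting (slope_annulus G o eps' theta' n)) / (n%:R : R)%:E)%E.
  by exists n.
apply: lee_wpmul2r; first by rewrite inve_ge0 lee_fin.
rewrite !counting_annulus lee_lne ?in_itv /= ?leey ?lee_fin ?ler0n //.
rewrite ler_nat; apply: subset_annulus_size; first exact: fset_uniq.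
move=> g; rewrite in_fset_set; last exact: finite_slope_annulus.
move=> /set_mem[Gg go gn gs]; split=> //.
by have := ler_distD theta (slope_angle o g) theta'; lra.
Qed.

Lemma growth_rate_le_eps eps theta : 0 < eps ->
  (growth_rate G o theta <= growth_eps G o eps theta)%E.
Proof.
move=> eps0; rewrite /growth_rate limf_einfE; apply: ge_ereal_sup => _ [V V0 <-].
have /filter_ex[e [Ve e0 ee]] : \forall e \near (0 : R)^'+, [/\ V e, 0 < e & e < eps].
  by near=> e; split; near: e; [|exact: nbhs_right_gt|exact: nbhs_right_lt].
apply: (@le_trans _ _ (growth_eps G o e theta)).
  by apply: ereal_inf_lbound; exists e.
by apply: growth_eps_le; rewrite subrr normr0 add0r ltW.
Unshelve. all: by end_near. Qed.

Lemma growth_rate_ge y theta :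
  (forall eps : R, 0 < eps -> (y <= growth_eps G o eps theta)%E) ->
  (y <= growth_rate G o theta)%E.
Proof.
move=> H; rewrite /growth_rate limf_einfE; apply: le_ereal_sup_tmp.
exists (ereal_inf ((fun e => growth_eps G o e theta) @` [set e | 0 < e])).
  by exists [set e | 0 < e] => //; exact: nbhs_right_gt.
by apply: le_ereal_inf_tmp => _ [e /= e0 <-]; exact: H.
Qed.

Lemma growth_rate_usc gamma y : (growth_rate G o gamma < y)%E -> exists2 e, 0 < e &
  forall gamma', `|gamma' - gamma| <= e -> (growth_rate G o gamma' < y)%E.
Proof.
move=> hy; have [e e0 he] : exists2 e, 0 < e & (growth_eps G o e gamma < y)%E.
  apply: contrapT => H; move: hy; rewrite ltNge => /negP; apply.
  apply: growth_rate_ge => e e0; rewrite leNgt; apply/negP => h.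
  by apply: H; exists e.
exists (e / 2); first by lra.
move=> gamma' hg; apply: le_lt_trans he.
apply: (le_trans (@growth_rate_le_eps (e / 2) gamma' ltac:(lra))).
by apply: growth_eps_le; lra.
Qed.

(** Compactness of the interval of slopes: a cluster point of the superlevel sets
  is a maximum. *)
Lemma growth_rate_max (a b : R) : a <= b -> exists2 gamma, a <= gamma <= b &
  forall gamma', a <= gamma' <= b -> (growth_rate G o gamma' <= growth_rate G o gamma)%E.
Proof.
move=> ab; move: (growth_rate G o) growth_rate_usc => f usc.
pose I := `[a, b]%classic.
pose D (g : R) := [set x | I x /\ (f g <= f x)%E].
have Ia : I a by rewrite /I /= in_itv /= lexx.
have FF : Filter (filter_from I D).
  apply: filter_from_filter; first by exists a.
  move=> g g' Ig Ig'; have [h|/ltW h] := leP (f g) (f g').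
    by exists g' => // x [Ix hx]; split; [exact: conj Ix (le_trans h hx)|].
  by exists g => // x [Ix hx]; split; [|exact: conj Ix (le_trans h hx)].
have PF : ProperFilter (filter_from I D).
  by apply: filter_from_proper => g Ig; exists g; split.
have [p [Ip cp]] := @segment_compact _ a b (filter_from I D) PF
  (ex_intro2 _ _ a Ia (fun x h => proj1 h)).
exists p; first by move: Ip; rewrite /= in_itv.
move=> g hg; rewrite leNgt; apply/negP => /usc[e e0 he].
have Ig : I g by rewrite /I /= in_itv.
have [x [[_ hx] px]] := cp (D g) (ball p e) (ex_intro2 _ _ g Ig (fun x h => h))
  (nbhsx_ballx p e e0).
by have := he x; rewrite distrC => /(_ (ltW px)); rewrite ltNge hx.
Qed.

End GrowthRate.

(** * Concavity of the growth rate *)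

Lemma iota_bound (N j K : nat) :
  (N < j)%N -> (j < N.+1 + (K - N))%N -> (j <= K)%N.
Proof. by lia. Qed.

Section RealEstimates.
Context {R : realType}.
Implicit Types (a b c k x y z : R).

Lemma expR_ge_sqr x : 0 <= x -> (x / 2) ^+ 2 <= expR x.
Proof.
move=> x0; have -> : expR x = expR (x / 2) ^+ 2.
  by rewrite expr2 -expRD; congr expR; field.
rewrite ler_pXn2r ?nnegrE ?expR_ge0 //; last by lra.
by have := expR_ge1Dx (x / 2); lra.
Qed.

Lemma expR_dominates_sqr (N : nat) k : 0 < k -> exists N0 : nat,
  forall n : nat, (N0 <= n)%N -> N%:R * n%:R ^+ 2 <= expR (k * n%:R).
Proof.
move=> k0; pose c := (k / 4) ^+ 4.
have c0 : 0 < c by rewrite exprn_gt0 // divr_gt0.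
exists (Num.bound (N%:R / c)).+1 => n Nn.
have n1 : 1 <= n%:R :> R by rewrite ler1n (leq_trans _ Nn).
have Nc : N%:R <= c * n%:R.
  rewrite mulrC -ler_pdivrMr //; apply: ltW.
  apply: lt_le_trans (archi_boundP _) _; first by rewrite divr_ge0 // ltW.
  by rewrite ler_nat ltnW.
have -> : expR (k * n%:R) = expR (k * n%:R / 2) ^+ 2.
  by rewrite expr2 -expRD; congr expR; field.
have kn0 : 0 <= k * n%:R by rewrite mulr_ge0 // ltW.
apply: (@le_trans _ _ ((((k * n%:R / 2) / 2) ^+ 2) ^+ 2)).
  have -> : ((k * n%:R / 2 / 2) ^+ 2) ^+ 2 = c * n%:R ^+ 2 * n%:R ^+ 2.
    by rewrite /c; field.
  rewrite ler_wpM2r ?sqr_ge0 //; apply: (le_trans Nc).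
  by rewrite expr2 mulrA ler_peMr // mulr_ge0 // ltW.
rewrite ler_pXn2r ?nnegrE ?sqr_ge0 ?expR_ge0 //.
by apply: expR_ge_sqr; lra.
Qed.

Lemma euclidean_norm_shift a b x y e : 0 <= e -> `|x - a| <= e -> `|y - b| <= e ->
  Num.sqrt (x ^+ 2 + y ^+ 2) <= Num.sqrt (a ^+ 2 + b ^+ 2) + 2 * e.
Proof.
move=> e0 xa yb; set c := Num.sqrt (a ^+ 2 + b ^+ 2).
have c0 : 0 <= c by exact: sqrtr_ge0.
have c2 : c ^+ 2 = a ^+ 2 + b ^+ 2 by rewrite sqr_sqrtr // addr_ge0 ?sqr_ge0.
have ac : `|a| <= c by rewrite -sqrtr_sqr ler_wsqrtr // lerDl sqr_ge0.
have bc : `|b| <= c by rewrite -sqrtr_sqr ler_wsqrtr // lerDr sqr_ge0.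
have sqle u v : `|u - v| <= e -> u ^+ 2 <= v ^+ 2 + 2 * e * `|v| + e ^+ 2.
  move=> uv; have -> : v ^+ 2 + 2 * e * `|v| + e ^+ 2 = (`|v| + e) ^+ 2.
    by rewrite -[v ^+ 2](real_normK (num_real v)); ring.
  rewrite -(real_normK (num_real u)) ler_pXn2r ?nnegrE ?addr_ge0 //.
  by have := ler_normD (u - v) v; rewrite subrK; lra.
rewrite -[leRHS]ger0_norm; last by lra.
rewrite -sqrtr_sqr ler_wsqrtr //.
have := sqle _ _ xa; have := sqle _ _ yb.
have := ler_wpM2l e0 ac; have := ler_wpM2l e0 bc; have := sqr_ge0 e.
have -> : (c + 2 * e) ^+ 2 = a ^+ 2 + b ^+ 2 + 4 * (e * c) + 4 * e ^+ 2.
  by rewrite -c2; ring.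
lra.
Qed.

Lemma cos_sin_close a k : 0 < k -> exists2 e, 0 < e & forall b, `|b - a| <= e ->
  `|cos b - cos a| <= k /\ `|sin b - sin a| <= k.
Proof.
move=> k0.
have hc := @continuous_cos R a; have hs := @continuous_sin R a.
move/(@cvgrPdist_le R R^o) : hc => /(_ k k0) hc.
move/(@cvgrPdist_le R R^o) : hs => /(_ k k0) hs.
have [e /= e0 he] : nbhs a (fun b => `|cos a - cos b| <= k /\ `|sin a - sin b| <= k).
  by near=> b; split; near: b.
exists (e / 2); first by lra.
move=> b ab; rewrite distrC (distrC (sin b)); apply: he.
by rewrite /ball /= distrC; lra.
Unshelve. all: by end_near. Qed.

Lemma atan_quotient_close a b e : 0 < a -> 0 < e -> exists2 z, 0 < z & forall x y,
  `|x - a| <= z -> `|y - b| <= z -> a / 2 <= x /\ `|atan (y / x) - atan (b / a)| <= e.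
Proof.
move=> a0 e0; have hc := @continuous_atan R (b / a).
move/(@cvgrPdist_le R R^o) : hc => /(_ e e0)[d /= d0 hd].
pose s := a + `|b|; have s0 : 0 < s by rewrite ltr_pwDl.
exists (Num.min (a / 2) (d * a ^+ 2 / (4 * s))).
  by rewrite lt_min !divr_gt0 ?mulr_gt0 ?exprn_gt0.
move=> x y; rewrite !le_min => /andP[x1 x2] /andP[_ y2].
have xa : a / 2 <= x by move: x1; rewrite ler_norml; lra.
split=> //; rewrite distrC; apply: hd; rewrite /ball /=.
have x0 : 0 < x by lra.
have -> : b / a - y / x = (b * (x - a) - a * (y - b)) / (a * x).
  by field; rewrite !gt_eqF.
rewrite normrM (gtr0_norm (_ : 0 < (a * x)^-1)) ?invr_gt0 ?mulr_gt0 //.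
rewrite ltr_pdivrMr ?mulr_gt0 //.
set w := d * a ^+ 2 / (4 * s) in x2 y2.
have ws : w * (4 * s) = d * a ^+ 2 by rewrite /w divfK // gt_eqF // mulr_gt0.
apply: (@le_lt_trans _ _ (w * s)).
  apply: (le_trans (ler_normB _ _)); rewrite !normrM (gtr0_norm a0) /s.
  by have := ler_wpM2l (normr_ge0 b) x2; have := ler_wpM2l (ltW a0) y2; lra.
have : d * (a * (a / 2)) <= d * (a * x) by rewrite !ler_pM2l.
have : 0 < d * a ^+ 2 by rewrite mulr_gt0 // exprn_gt0.
lra.
Qed.

End RealEstimates.

Section Concavity.
Context {R : realType} (X1 X2 : metricType R).
Hypothesis (hX1 : Hadamard_space X1) (pX1 : proper_space X1).
Hypothesis (hX2 : Hadamard_space X2) (pX2 : proper_space X2).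
Local Notation elt := ((X1 -> X1) * (X2 -> X2))%type.
Variables (o : X1 * X2) (G : set elt).
Hypothesis hG : isometry_group G.
Hypothesis pG : acts_properly G.
Hypothesis hrank : exists g h : elt,
  [/\ G g, G h, independent_rank_one g.1 h.1 & independent_rank_one g.2 h.2].

Local Notation displ1 := (displ1 o).
Local Notation displ2 := (displ2 o).
Local Notation displ := (fun g => prod_dist o (prod_act g o)).

Lemma displ_polar g :
  displ1 g = displ g * cos (slope_angle o g) /\
  displ2 g = displ g * sin (slope_angle o g).
Proof.
rewrite /slope_angle /prod_dist /= /displ1 /displ2.
have := mdist_ge0 o.1 (g.1 o.1); have := mdist_ge0 o.2 (g.2 o.2).
move: (mdist o.1 _) (mdist o.2 _) => x y y0 x0.
have [->|xn] := eqVneq x 0.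
  by rewrite cos_pihalf sin_pihalf expr0n /= add0r sqrtr_sqr ger0_norm // mulr0 mulr1.
have xp : 0 < x by rewrite lt_neqAle eq_sym xn.
have rt : 0 < Num.sqrt (1 + (y / x) ^+ 2).
  by rewrite sqrtr_gt0 ltr_pwDl // sqr_ge0.
have e1 : x = Num.sqrt (x ^+ 2 + y ^+ 2) * cos (atan (y / x)).
  rewrite cos_atan; have -> : x ^+ 2 + y ^+ 2 = x ^+ 2 * (1 + (y / x) ^+ 2) by field.
  by rewrite sqrtrM ?sqr_ge0 // sqrtr_sqr gtr0_norm // mulfK // gt_eqF.
split=> //.
have cn : cos (atan (y / x)) != 0 by rewrite cos_atan invr_eq0 gt_eqF.
have -> : sin (atan (y / x)) = cos (atan (y / x)) * (y / x).
  move: cn (atanK (y / x)); rewrite /tan; move: (atan _) => A cn <-.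
  by rewrite mulrC divfK.
by rewrite mulrA -e1; field.
Qed.

Lemma displ_sqrt g : displ g = Num.sqrt (displ1 g ^+ 2 + displ2 g ^+ 2).
Proof. by []. Qed.

Let annulus_displ alpha k e n g : 0 < k ->
    (forall b, `|b - alpha| <= e -> `|cos b - cos alpha| <= k /\
      `|sin b - sin alpha| <= k) ->
    slope_annulus G o e alpha n g ->
  [/\ G g, displ1 g < n%:R, displ2 g < n%:R &
    near_displ o (n%:R * cos alpha, n%:R * sin alpha) (1 + n%:R * k) g].
Proof.
move=> k0 hk [Gg _ /andP[g1 g2] gs]; have [c1 c2] := hk _ gs.
have [p1 p2] := displ_polar g.
have d0 : 0 <= displ g by exact: sqrtr_ge0.
have le1 x b z : `|x| <= 1 -> `|x - b| <= k -> z = displ g * x ->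
    z < n%:R /\ `|z - n%:R * b| <= 1 + n%:R * k.
  move=> x1 xb ->; have n0 : 0 <= n%:R :> R by rewrite ler0n.
  have xl : x <= 1 by apply: le_trans x1; exact: ler_norm.
  split; first by have := ler_wpM2l d0 xl; lra.
  have -> : displ g * x - n%:R * b = (displ g - n%:R) * x + n%:R * (x - b) by ring.
  apply: (le_trans (ler_normD _ _)); rewrite !normrM (ger0_norm n0).
  apply: lerD; last exact: ler_wpM2l.
  rewrite -[leRHS]mulr1; apply: ler_pM => //.
  by rewrite ler_norml; lra.
have [a1 b1] := le1 _ _ _ (cos_max _) c1 p1.
have [a2 b2] := le1 _ _ _ (sin_max _) c2 p2.
by split.
Qed.

(** The words have J t n' letters of length about n and slope near alpha, and J n letters
  of length about n' and slope near theta, so that m = J n n'.  For large n and n',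
  the constant errors and polynomial losses of each letter are absorbed by k. *)
Lemma many_products alpha theta a b (t : nat) k M :
    (a%:E < growth_rate G o alpha)%E -> (b%:E < growth_rate G o theta)%E -> 0 < k ->
  exists (m : R) (W : seq elt), [/\ M <= m, 1 <= m,
    uniq W /\ (forall u, u \in W -> G u),
    expR (m * (t%:R * a + b - (t%:R + 1) * k)) <= (size W)%:R &
    forall u, u \in W ->
      `|displ1 u - m * (t%:R * cos alpha + cos theta)| <= m * (2 * k * (t%:R + 1)) /\
      `|displ2 u - m * (t%:R * sin alpha + sin theta)| <= m * (2 * k * (t%:R + 1))].
Proof.
move=> ha hb k0.
have [K [N1 [K0 N10 words]]] := word_count hX1 pX1 hX2 pX2 o hG pG hrank.
have [N0 poly] := expR_dominates_sqr N1 k0.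
pose N3 := (N0 + Num.bound ((1 + K) / k))%N.
have big n : (N3 <= n)%N -> 1 + K <= k * n%:R.
  move=> Nn; rewrite mulrC -ler_pdivrMr //; apply: ltW.
  apply: lt_le_trans (archi_boundP _) _.
    by apply: divr_ge0 (ltW k0); lra.
  by rewrite ler_nat (leq_trans _ Nn) // leq_addl.
have bigpoly n : (N3 <= n)%N -> (N1 * n ^ 2)%:R <= expR (k * n%:R).
  by move=> Nn; rewrite natrM natrX poly // (leq_trans _ Nn) // leq_addr.
have [e1 e10 he1] := cos_sin_close alpha k0.
have [e2 e20 he2] := cos_sin_close theta k0.
have [n [N3n n0 cardn]] := growth_eps_gt pG
  (lt_le_trans ha (growth_rate_le_eps o pG alpha e10)) N3.
have [n' [N3n' n'0 cardn']] := growth_eps_gt pG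
  (lt_le_trans hb (growth_rate_le_eps o pG theta e20)) N3.
pose S := enum_fset (fset_set (slope_annulus G o e1 alpha n)).
pose S' := enum_fset (fset_set (slope_annulus G o e2 theta n')).
have hS h : h \in S -> [/\ G h, displ1 h < n%:R, displ2 h < n%:R &
    near_displ o (n%:R * cos alpha, n%:R * sin alpha) (1 + n%:R * k) h].
  rewrite /S in_fset_set; last exact: finite_slope_annulus.
  by move=> /set_mem; exact: annulus_displ.
have hS' h : h \in S' -> [/\ G h, displ1 h < n'%:R, displ2 h < n'%:R &
    near_displ o (n'%:R * cos theta, n'%:R * sin theta) (1 + n'%:R * k) h].
  rewrite /S' in_fset_set; last exact: finite_slope_annulus.
  by move=> /set_mem; exact: annulus_displ.
have {}words := words S S' n n' _ _ _ _ (fset_uniq _) (fset_uniq _) hS hS'.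
pose J := (Num.bound `|M|).+1.
have [W [uW GW sizeW dW]] := words (J * t * n')%N (J * n)%N.
have MJ : M <= J%:R.
  apply: (le_trans (ler_norm M)); apply: ltW; apply: lt_le_trans (archi_boundP _) _.
    exact: normr_ge0.
  by rewrite ler_nat.
have J1 : 1 <= J%:R :> R by rewrite ler1n.
exists (J * n * n')%:R, W; split => //.
- by apply: (le_trans MJ); rewrite ler_nat -mulnA leq_pmulr // muln_gt0 n0.
- by apply: (le_trans J1); rewrite ler_nat -mulnA leq_pmulr // muln_gt0 n0.
- have pos : 0 < (N1 * n ^ 2)%:R ^+ (J * t * n') * (N1 * n' ^ 2)%:R ^+ (J * n) :> R.
    by rewrite mulr_gt0 // exprn_gt0 // ltr0n muln_gt0 N10 expn_gt0 ?n0 ?n'0.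
  rewrite -(ler_pM2l pos).
  apply: (@le_trans _ _ ((size S ^ (J * t * n') * size S' ^ (J * n))%:R)); last first.
    by rewrite -!natrX -!natrM ler_nat.
  apply: (@le_trans _ _ (expR (k * n%:R) ^+ (J * t * n') *
      expR (k * n'%:R) ^+ (J * n) *
      expR ((J * n * n')%:R * (t%:R * a + b - (t%:R + 1) * k)))).
    rewrite ler_wpM2r ?expR_ge0 //; apply: ler_pM; rewrite ?exprn_ge0 //.
      by apply: lerXn2r; rewrite ?nnegrE ?expR_ge0 // bigpoly.
    by apply: lerXn2r; rewrite ?nnegrE ?expR_ge0 // bigpoly.
  apply: (@le_trans _ _ (expR (a * n%:R) ^+ (J * t * n') *
      expR (b * n'%:R) ^+ (J * n))); last first.
    rewrite natrM !natrX; apply: ler_pM; rewrite ?exprn_ge0 ?expR_ge0 //.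
      by apply: lerXn2r; rewrite ?nnegrE ?expR_ge0.
    by apply: lerXn2r; rewrite ?nnegrE ?expR_ge0.
  rewrite -!expRM_natl -!expRD ler_expR le_eqVlt; apply/orP; left; apply/eqP.
  by rewrite !natrM; ring.
- move=> u /dW; rewrite /near_displ /=.
  have -> : (J * t * n')%:R * (n%:R * cos alpha) + (J * n)%:R * (n'%:R * cos theta)
    = (J * n * n')%:R * (t%:R * cos alpha + cos theta) by rewrite !natrM; ring.
  have -> : (J * t * n')%:R * (n%:R * sin alpha) + (J * n)%:R * (n'%:R * sin theta)
    = (J * n * n')%:R * (t%:R * sin alpha + sin theta) by rewrite !natrM; ring.
  suff : (J * t * n')%:R * (1 + n%:R * k + K) + (J * n)%:R * (1 + n'%:R * k + K)
      <= (J * n * n')%:R * (2 * k * (t%:R + 1)).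
    by move=> h [d1 d2]; split; [exact: le_trans d1 h|exact: le_trans d2 h].
  have -> : (J * n * n')%:R * (2 * k * (t%:R + 1)) =
      (J * t * n')%:R * (2 * (k * n%:R)) + (J * n)%:R * (2 * (k * n'%:R)).
    by rewrite !natrM; ring.
  have := big n N3n; have := big n' N3n'; rewrite !(mulrC k).
  move: (n%:R * k) (n'%:R * k) => x x' hx' hx.
  by apply: lerD; apply: ler_wpM2l; rewrite ?ler0n //; lra.
Qed.

(** Extended from slopes to vectors as a homogeneous function of degree one, the growth
  rate is superadditive: many_products yields exponentially many elements near the
  multiples of t e_alpha + e_theta, and only linearly many annuli to contain them. *)
Lemma growth_rate_superadditive alpha theta a b y (t : nat) :
    (a%:E < growth_rate G o alpha)%E -> (b%:E < growth_rate G o theta)%E ->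
    let H1 := t%:R * cos alpha + cos theta in
    let H2 := t%:R * sin alpha + sin theta in
    0 < H1 -> 0 < y -> y * Num.sqrt (H1 ^+ 2 + H2 ^+ 2) < t%:R * a + b ->
  (y%:E <= growth_rate G o (atan (H2 / H1)))%E.
Proof.
move=> ha hb H1 H2 H10 y0 hy; apply: growth_rate_ge => eps2 eps20.
apply: growth_eps_ge => // N2; apply: contrapT => Nex.
have {Nex} small n : (N2 <= n)%N -> (0 < n)%N ->
    (annulus_size o G eps2 (atan (H2 / H1)) n)%:R < expR (y * n%:R).
  by move=> N2n n0; rewrite ltNge; apply/negP => h; apply: Nex; exists n.
have := @many_products alpha theta a b t _ _ ha hb.
rewrite -/H1 -/H2; move: hy; move: (t%:R * a + b) => ab.
have : 0 <= t%:R :> R by rewrite ler0n.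
move: (t%:R : R) => T T0; move: H1 H2 H10 small => H1 H2 H10 small {ha hb}.
set c := Num.sqrt _ => hy products.
have c0 : 0 <= c by exact: sqrtr_ge0.
have [z z0 hz] := atan_quotient_close H2 H10 eps20.
(* The first bound keeps the slopes of the products within eps2, the second one keeps
  their exponential rate above y. *)
pose k := Num.min (z / (2 * (T + 1))) ((ab - y * c) / (2 * ((T + 1) * (1 + 4 * y)))).
have tp : 0 < T + 1 by lra.
have gap0 : 0 < ab - y * c by rewrite subr_gt0.
have yp : 0 < 1 + 4 * y by lra.
have k0 : 0 < k by rewrite lt_min !divr_gt0 ?mulr_gt0.
have kz : 2 * k * (T + 1) <= z.
  have : k <= z / (2 * (T + 1)) by rewrite ge_min lexx.
  by rewrite ler_pdivlMr ?mulr_gt0 //; lra.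
have kgap : 2 * (k * ((T + 1) * (1 + 4 * y))) <= ab - y * c.
  have : k <= (ab - y * c) / (2 * ((T + 1) * (1 + 4 * y))).
    by rewrite ge_min lexx orbT.
  by rewrite ler_pdivlMr ?mulr_gt0 //; lra.
move: k k0 kz kgap => k k0 kz kgap.
pose c2 := c + 4 * k * (T + 1).
pose g := ab - (T + 1) * k.
have gc2 : 0 < g - y * c2.
  have : 0 < k * ((T + 1) * (1 + 4 * y)) by rewrite !mulr_gt0.
  by rewrite /g /c2; lra.
have c20 : 0 <= c2 by rewrite addr_ge0 // !mulr_ge0 // ltW.
(* For m above this bound there are more products than the relevant annuli hold. *)
pose M := `|N2%:R * 2 / H1| + `|4 * ((c2 + 2) * expR y) / (g - y * c2) ^+ 2| + 1.
have [m [W [Mm m1 [uW GW] sizeW near_u]]] := products k M k0.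
have mp : 0 < m by exact: lt_le_trans m1.
have displ_le u : u \in W -> displ u <= m * c2.
  move=> /near_u[d1 d2]; rewrite displ_sqrt.
  have mk0 : 0 <= m * (2 * k * (T + 1)) by rewrite !mulr_ge0 ?(ltW mp) ?(ltW k0) ?(ltW tp).
  apply: (le_trans (euclidean_norm_shift mk0 d1 d2)).
  have -> : (m * H1) ^+ 2 + (m * H2) ^+ 2 = m ^+ 2 * (H1 ^+ 2 + H2 ^+ 2) by ring.
  rewrite sqrtrM ?sqr_ge0 // sqrtr_sqr (gtr0_norm mp) -/c /c2.
  by lra.
have slope_u u : u \in W -> m * (H1 / 2) <= displ1 u /\
    `|slope_angle o u - atan (H2 / H1)| <= eps2.
  move=> /near_u[d1 d2].
  have mn : m != 0 by rewrite gt_eqF.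
  have scale v h : `|v - m * h| <= m * (2 * k * (T + 1)) -> `|v / m - h| <= z.
    have -> : v - m * h = m * (v / m - h) by field.
    by rewrite normrM (gtr0_norm mp) ler_pM2l // => /le_trans; apply.
  have [h1 h2] := hz _ _ (scale _ _ d1) (scale _ _ d2).
  rewrite ler_pdivlMr // mulrC in h1; split=> //.
  have d10 : displ1 u != 0.
    by rewrite gt_eqF //; apply: lt_le_trans h1; rewrite mulr_gt0 // divr_gt0.
  rewrite /slope_angle -/(displ1 u) -/(displ2 u) (negbTE d10).
  move: h2; have -> // : displ2 u / m / (displ1 u / m) = displ2 u / displ1 u.
  by field; rewrite d10 mn.
pose Kmax := (Num.truncn (m * c2)).+1.
have Kmax_le : Kmax%:R <= m * c2 + 1.
  have mc0 : 0 <= m * c2 by rewrite mulr_ge0 // ltW.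
  by rewrite -natr1 lerD2r; have /andP[] := truncn_itv mc0.
pose annulus n := enum_fset (fset_set (slope_annulus G o eps2 (atan (H2 / H1)) n)).
have cover u : u \in W -> exists2 n, (N2 < n <= Kmax)%N & u \in annulus n.
  move=> uW'; have [d1 su] := slope_u u uW'; have dl := displ_le u uW'.
  have du0 : 0 <= displ u by exact: sqrtr_ge0.
  have d1u : displ1 u <= displ u.
    rewrite displ_sqrt -{1}(ger0_norm (mdist_ge0 _ _ : 0 <= displ1 u)) -sqrtr_sqr.
    by rewrite ler_wsqrtr // lerDl sqr_ge0.
  have /andP[t1 t2] := truncn_itv du0.
  have dN : N2%:R <= displ u.
    apply: le_trans (le_trans d1 d1u).
    have : N2%:R * 2 / H1 <= m.
      apply: le_trans Mm; rewrite /M -addrA.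
      by apply: (le_trans (ler_norm _)); rewrite lerDl addr_ge0.
    by rewrite ler_pdivrMr // mulrA ler_pdivlMr.
  exists (Num.truncn (displ u)).+1.
    apply/andP; split; first by rewrite -(ltr_nat R) (le_lt_trans dN).
    by rewrite ltnS; exact: le_truncn.
  rewrite /annulus in_fset_set; last exact: finite_slope_annulus.
  apply/mem_set; split=> //; first exact: GW.
    move=> uo; have : displ u = 0.
      by cbv beta; rewrite uo /prod_dist !mdistxx expr0n /= addr0 sqrtr0.
    apply/eqP; rewrite gt_eqF //; apply: lt_le_trans (le_trans d1 d1u).
    by rewrite mulr_gt0 // divr_gt0.
  by rewrite t2 -natr1 addrK t1.
have sizeW_le : (size W)%:R <= Kmax.+1%:R * expR (y * Kmax%:R).
  pose L := flatten [seq annulus n | n <- iota N2.+1 (Kmax - N2)].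
  have : (size W <= size L)%N.
    apply: uniq_leq_size => // u /cover[j /andP[j1 j2] uj].
    apply/flattenP; exists (annulus j) => //; apply: map_f.
    by rewrite mem_iota j1 /= addSn ltnS subnKC // ltnW // (leq_trans j1).
  rewrite -(ler_nat R) => /le_trans; apply.
  rewrite size_flatten sumnE /shape -map_comp big_map natr_sum.
  apply: (@le_trans _ _ (\sum_(j <- iota N2.+1 (Kmax - N2)) expR (y * Kmax%:R))).
    rewrite big_seq_cond [leRHS]big_seq_cond; apply: ler_sum => j.
    rewrite mem_iota andbT => /andP[j1 j2].
    apply: ltW; apply: lt_le_trans (small j (ltnW j1) (leq_ltn_trans _ j1)) _ => //.
    by rewrite ler_expR ler_pM2l // ler_nat (iota_bound j1 j2).
  rewrite big_const_seq count_predT size_iota iter_addr addr0 -[_ *+ _]mulr_natl.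
  by rewrite ler_wpM2r ?expR_ge0 // ler_nat (leq_trans (leq_subr _ _)).
have : expR (m * (g - y * c2)) <= m * ((c2 + 2) * expR y).
  have := le_trans sizeW sizeW_le; rewrite -/g.
  have -> : m * g = m * (g - y * c2) + y * (m * c2) by ring.
  rewrite expRD -ler_pdivlMr ?expR_gt0 // => /le_trans; apply.
  rewrite ler_pdivrMr ?expR_gt0 //.
  have -> : m * ((c2 + 2) * expR y) * expR (y * (m * c2)) =
      (m * (c2 + 2)) * expR (y * (m * c2 + 1)).
    by rewrite (mulrDr y) mulr1 expRD; ring.
  apply: ler_pM; rewrite ?expR_ge0 //; last by rewrite ler_expR ler_pM2l.
  by rewrite -natr1; lra.
have mg0 : 0 <= m * (g - y * c2) by rewrite mulr_ge0 // ltW.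
move=> /(le_trans (expR_ge_sqr mg0)).
have -> : (m * (g - y * c2) / 2) ^+ 2 = m * (m * (g - y * c2) ^+ 2 / 4).
  by field.
rewrite ler_pM2l //; apply/negP; rewrite -ltNge ltr_pdivlMr // (mulrC _ 4).
rewrite -ltr_pdivrMr ?exprn_gt0 //; apply: lt_le_trans Mm.
apply: (le_lt_trans (ler_norm _)); rewrite /M.
by apply: ltr_pwDr => //; rewrite lerDr.
Qed.

End Concavity.

(** * The maximum of the growth rate *)

Section InteriorMaximum.
Context {R : realType} (X1 X2 : metricType R).
Hypothesis (hX1 : Hadamard_space X1) (pX1 : proper_space X1).
Hypothesis (hX2 : Hadamard_space X2) (pX2 : proper_space X2).
Local Notation elt := ((X1 -> X1) * (X2 -> X2))%type.
Variables (o : X1 * X2) (G : set elt).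
Hypothesis hG : isometry_group G.
Hypothesis pG : acts_properly G.
Hypothesis hrank : exists g h : elt,
  [/\ G g, G h, independent_rank_one g.1 h.1 & independent_rank_one g.2 h.2].

(** The norm of t e_alpha + e_theta is t + cos (alpha - theta) up to O(1/t), while
  superadditivity bounds the growth at this vector from below by t D + b; if
  D cos (alpha - theta) < b, the quotient exceeds D for large t. *)
Lemma growth_rate_improves alpha theta D b :
    0 <= cos alpha -> 0 <= sin alpha -> 0 < theta < pi / 2 -> 0 < D ->
    (D%:E <= growth_rate G o alpha)%E -> (b%:E < growth_rate G o theta)%E ->
    D * cos (alpha - theta) < b ->
  exists2 phi, 0 < phi < pi / 2 & (D%:E < growth_rate G o phi)%E.
Proof.
move=> ca sa ht D0 hD hb; rewrite cosB.
set s := _ + _ => Db.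
have /andP[t0 t1] := ht; have pi0 := pi_gt0 R.
have ct : 0 < cos theta by apply: cos_gt0_pihalf; lra.
have st : 0 < sin theta by exact: sin_gt0_pihalf.
have s0 : 0 <= s by rewrite addr_ge0 // mulr_ge0 // ltW.
(* The norm of the vector is at most t + s' for large t, and D s' < b. *)
pose s' := (s + b / D) / 2.
have bD : b / D * D = b by rewrite divfK // gt_eqF.
have Ds' : D * s' = (D * s + b) / 2.
  have -> : D * s' = (D * s + b / D * D) / 2 by rewrite /s'; ring.
  by rewrite bD.
have ss' : s < s' by rewrite -(ltr_pM2l D0) Ds'; lra.
pose t := (Num.bound (2^-1 / (s' - s))).+1.
have tlarge : 2^-1 <= t%:R * (s' - s).
  rewrite -ler_pdivrMr ?subr_gt0 //; apply: ltW.
  apply: lt_le_trans (archi_boundP _) _; last by rewrite ler_nat.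
  by apply: divr_ge0; rewrite ?invr_ge0 ?ler0n // subr_ge0 ltW.
have tp : 0 < t%:R :> R by rewrite ltr0n.
pose H1 := t%:R * cos alpha + cos theta; pose H2 := t%:R * sin alpha + sin theta.
have H10 : 0 < H1 by rewrite /H1 ltr_wpDl // mulr_ge0.
have H20 : 0 < H2 by rewrite /H2 ltr_wpDl // mulr_ge0.
have norm_le : Num.sqrt (H1 ^+ 2 + H2 ^+ 2) <= t%:R + s'.
  rewrite -[leRHS]ger0_norm; last by lra.
  rewrite -sqrtr_sqr ler_wsqrtr //.
  have := cos2Dsin2 alpha; have := cos2Dsin2 theta => c1 c2.
  have -> : H1 ^+ 2 + H2 ^+ 2 = t%:R ^+ 2 * (cos alpha ^+ 2 + sin alpha ^+ 2)
      + (cos theta ^+ 2 + sin theta ^+ 2) + 2 * t%:R * s.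
    by rewrite /H1 /H2 /s; ring.
  rewrite c1 c2; have := sqr_ge0 s'.
  by move: (t%:R) tlarge => T; lra.
have n0 : 0 <= Num.sqrt (H1 ^+ 2 + H2 ^+ 2) by exact: sqrtr_ge0.
move: norm_le n0 (@growth_rate_superadditive R X1 X2 hX1 pX1 hX2 pX2 o G hG pG
  hrank alpha theta) => + + superadd.
set n := Num.sqrt _ => norm_le n0.
have gap : 0 < t%:R * D + b - D * n.
  have := ler_wpM2l (ltW D0) norm_le; rewrite mulrDr Ds'.
  by move: (t%:R) => T; lra.
pose e := (t%:R * D + b - D * n) / (2 * (n + t%:R)).
have nt0 : 0 < n + t%:R by rewrite ltr_wpDl.
have e0 : 0 < e by rewrite divr_gt0 // mulr_gt0.
have ent : e * (2 * (n + t%:R)) = t%:R * D + b - D * n.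
  by rewrite /e divfK // gt_eqF // mulr_gt0.
exists (atan (H2 / H1)); first by rewrite atan_ltpi2 -atan0 lt_atan // divr_gt0.
apply: (@lt_le_trans _ _ (D + e)%:E); first by rewrite lte_fin ltrDl.
have hDe : ((D - e)%:E < growth_rate G o alpha)%E.
  by apply: lt_le_trans hD; rewrite lte_fin gtrBl.
have hn : (D + e) * n < t%:R * (D - e) + b.
  by move: (t%:R) gap ent => T; lra.
exact: superadd hDe hb H10 (addr_gt0 D0 e0) hn.
Qed.

(** At a maximum alpha, the growth rate would be positive and, by the bound on the
  quotient, finite; then growth_rate_improves yields a larger growth rate. *)
Lemma max_not_at alpha theta r :
    0 <= cos alpha -> 0 <= sin alpha -> 0 < theta < pi / 2 ->
    0 < cos (alpha - theta) -> 0 < r -> growth_rate G o theta = r%:E ->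
    (growth_rate G o alpha / growth_rate G o theta
      < ((cos (alpha - theta))^-1)%:E)%E ->
    (forall gamma, 0 <= gamma <= pi / 2 ->
      (growth_rate G o gamma <= growth_rate G o alpha)%E) -> False.
Proof.
move=> ca sa ht c0 r0 hr; rewrite hr inver gt_eqF // lte_pdivrMr // -EFinM.
move=> lt_alpha hmax.
have tI : 0 <= theta <= pi / 2 by move/andP: ht => [? ?]; lra.
have := hmax theta tI; rewrite hr.
move: (growth_rate G o alpha) lt_alpha hmax (@growth_rate_improves alpha theta)
  => [D| |] //=; rewrite lte_fin lee_fin => ltD hmax improves rD.
have D0 : 0 < D by exact: lt_le_trans rD.
have Dr : D * cos (alpha - theta) < r.
  by rewrite mulrC -ltr_pdivlMl.
have [phi hphi] := improves D ((D * cos (alpha - theta) + r) / 2) ca sa ht D0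
  (lexx _) ltac:(by rewrite hr lte_fin; lra) ltac:(lra).
rewrite ltNge => /negP; apply; apply: hmax.
by move/andP: hphi => [? ?]; lra.
Qed.

End InteriorMaximum.

Unset Implicit Arguments.

Theorem theorem1p11 (R : realType) (X1 X2 : metricType R)
  (hX1 : Hadamard_space X1) (pX1 : proper_space X1)
  (hX2 : Hadamard_space X2) (pX2 : proper_space X2)
  (o : X1 * X2) (G : set ((X1 -> X1) * (X2 -> X2)))
  (hG : isometry_group G) (pG : acts_properly G)
  (hrank : exists g h : (X1 -> X1) * (X2 -> X2),
     [/\ G g, G h, independent_rank_one g.1 h.1 &
         independent_rank_one g.2 h.2])
  (hpos : forall gamma : R, 0 < gamma < pi / 2 ->
     (0 < growth_rate G o gamma)%E)
  (hslope : exists theta beta : R,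
     [/\ 0 < theta < pi / 2, 0 < beta < pi / 2,
         (growth_rate G o (pi / 2) / growth_rate G o theta
            < ((sin theta)^-1)%:E)%E &
         (growth_rate G o 0 / growth_rate G o (pi / 2 - beta)
            < ((sin beta)^-1)%:E)%E]) :
  exists thetastar : R, 0 < thetastar < pi / 2 /\
    forall theta : R, 0 <= theta <= pi / 2 ->
      (growth_rate G o theta <= growth_rate G o thetastar)%E.
Proof.
have [theta [beta [ht hbeta h1 h2]]] := hslope.
have pi0 := pi_gt0 R.
have hb : 0 < pi / 2 - beta < pi / 2 by lra.
(* An infinite growth rate is maximal. *)
have fin gamma : 0 < gamma < pi / 2 -> (exists thetastar : R,
    0 < thetastar < pi / 2 /\ forall theta : R, 0 <= theta <= pi / 2 ->
      (growth_rate G o theta <= growth_rate G o thetastar)%E) \/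
    exists2 r, 0 < r & growth_rate G o gamma = r%:E.
  move=> hg; move: (hpos gamma hg); case e: (growth_rate G o gamma) => [r| |] //.
  - by move=> r0; right; exists r.
  - by move=> _; left; exists gamma; split; [exact: hg|move=> t _; rewrite e leey].
have [//|[r r0 hr]] := fin theta ht.
have [//|[r' r'0 hr']] := fin (pi / 2 - beta) hb.
have [gamma hg hmax] := @growth_rate_max R X1 X2 o G pG 0 (pi / 2) ltac:(lra).
have sb : 0 < sin beta by exact: sin_gt0_pihalf.
have st : 0 < sin theta by exact: sin_gt0_pihalf.
have e1 : cos (pi / 2 - theta) = sin theta by rewrite -cosN opprB cosBpihalf.
have e2 : cos (0 - (pi / 2 - beta)) = sin beta by rewrite sub0r opprB cosBpihalf.
have [g0|g0] := eqVneq gamma 0.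
  exfalso; rewrite g0 in hmax.
  apply: (@max_not_at R X1 X2 hX1 pX1 hX2 pX2 o G hG pG hrank 0 (pi / 2 - beta) r');
    by rewrite ?cos0 ?sin0 ?e2.
have [g1|g1] := eqVneq gamma (pi / 2).
  exfalso; rewrite g1 in hmax.
  apply: (@max_not_at R X1 X2 hX1 pX1 hX2 pX2 o G hG pG hrank (pi / 2) theta r);
    by rewrite ?cos_pihalf ?sin_pihalf ?e1.
exists gamma; split; last exact: hmax.
by move/andP: hg => [? ?]; rewrite !lt_neqAle eq_sym g0 g1 /=; lra.
Qed.
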